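(* Let $r>1$. Suppose that for each $\tau>0$ the pruning operation $\mathcal{P}_\tau$ generates an error $O(\tau^r)$ (as defined in the context). Suppose the data satisfy Assumptions (A1) and (A2) stated in the context, and let $\lambda\in[\lambda_1,\lambda_2)$ and $\epsilon>0$ be such that $M_t^m[P_0]\in[\epsilon I,\lambda I]$ for all $m\in\mathcal{M}$, $t\ge0$ and $P_0\in[\epsilon I,\lambda I]$. Then there exist $\tau_0>0$ and $L>0$ such that $$S_{N\tau}[V^0](x)-\{\mathcal{P}_\tau\circ\tilde S_\tau\}^N[V^0](x)\le L\,\tau^{\min\{1,r-1\}}|x|^2\qquad\text{for all }x\in\mathbb{R}^n,$$ for all $N\in\mathbb{N}$, all $0<\tau\le\tau_0$ and all functions $V^0(x)=\frac12x'P_0x$ with $P_0\in[\epsilon I,\lambda I]$.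
   Context: Data: a finite set $\mathcal{M}=\{1,\dots,M\}$, a real $\gamma>0$, and for each $m\in\mathcal{M}$ matrices $A^m\in\mathbb{R}^{n\times n}$, $\sigma^m\in\mathbb{R}^{n\times k}$ and symmetric $D^m\in\mathbb{R}^{n\times n}$. Put $\Sigma^m:=\frac{1}{\gamma^2}\sigma^m(\sigma^m)'$ (prime denotes transpose). Assumption (A1): there are constants $c_A,c_\sigma,c_D>0$ such that for all $m\in\mathcal{M}$ and $x\in\mathbb{R}^n$: $x'A^mx\le -c_A|x|^2$; $|\sigma^m|\le c_\sigma$ (operator norm); $D^m$ is positive definite with $x'D^mx\le c_D|x|^2$; and $c_A^2>c_Dc_\sigma^2/\gamma^2$. Assumption (A2): there is $m_D>0$ with $x'D^mx\ge m_D|x|^2$ for all $x\in\mathbb{R}^n$, $m\in\mathcal{M}$, and $\frac{c_\sigma^2}{\gamma^2}m_D>\big(c_A-\sqrt{c_A^2-c_Dc_\sigma^2/\gamma^2}\big)^2$. Fix such constants and set $\lambda_1=\frac{\gamma^2\left(c_A-\sqrt{c_A^2-c_Dc_\sigma^2/\gamma^2}\right)}{c_\sigma^2}$, $\lambda_2=\sqrt{m_D\gamma^2/c_\sigma^2}$. Control problem: $\mathcal{W}$ is the set of measurable $w:[0,\infty)\to\mathbb{R}^k$ with $\int_0^T|w_t|^2dt<\infty$ for all $T<\infty$; $\mathcal{D}_T$ is the set of measurable $\mu:[0,T)\to\mathcal{M}$. Given $x,w,\mu$, the trajectory $\xi$ solves $\dot\xi_t=A^{\mu_t}\xi_t+\sigma^{\mu_t}w_t$,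 $\xi_0=x$, and $$J(x,T;V^0;w,\mu)=\int_0^T\tfrac12\xi_t'D^{\mu_t}\xi_t-\tfrac{\gamma^2}{2}|w_t|^2\,dt+V^0(\xi_T).$$ Semigroups: $S_T[V^0](x)=\sup_{w\in\mathcal{W}}\sup_{\mu\in\mathcal{D}_T}J(x,T;V^0;w,\mu)$; $S^m_T[V^0](x)=\sup_{w\in\mathcal{W}}J(x,T;V^0;w,\mu^m)$ with $\mu^m\equiv m$; $\tilde S_\tau[V^0]=\sup_{m\in\mathcal{M}}S^m_\tau[V^0]$. Riccati flows: $\Phi_m(P)=(A^m)'P+PA^m+P\Sigma^mP+D^m$ on symmetric $n\times n$ matrices; $M^m_t[P_0]=P(t)$, where $P(\cdot)$ is the maximal solution of $\dot P=\Phi_m(P)$, $P(0)=P_0$. One has $S^m_t[\frac12x'P_0x]=\frac12x'M^m_t[P_0]x$ as long as the Riccati solution exists. The order $\le$ on symmetric matrices is the Loewner order and $[A,B]=\{P\text{ symmetric}:A\le P\le B\}$. Pruning: let $\{f_i\}_{i\in I}$ be a finite set of quadratic functions and $f=\sup_{i\in I}f_i$. A pruning operation $\mathcal{P}$ applied to $f$ selects a subset $J\subset I$ and returns $\mathcal{P}[f]=\sup_{j\in J}f_j$. The pruning operations $\mathcal{P}_\tau$, $\tau>0$, generate an error $O(\tau^r)$ if there is $L>0$ such that $\mathcal{P}_\tau[f]\le f\le(1+L\tau^r)\mathcal{P}_\tau[f]$ (pointwise) for all functions $f$ that are suprema of a finite set of quadratic functions. In the iteration $\{\mathcal{P}_\tau\circ\tilde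 S_\tau\}^N[V^0]$, $\tilde S_\tau$ applied to $\sup_{j\in J}f_j$ is regarded as the supremum of the functions $S^m_\tau[f_j]$, $(m,j)\in\mathcal{M}\times J$, to which $\mathcal{P}_\tau$ is then applied. *)

(* Defs.v *)
From HB Require Import structures.
From mathcomp Require Import all_boot all_order all_algebra.
From mathcomp Require Import all_classical all_reals all_analysis.

Set Implicit Arguments.
Unset Strict Implicit.
Unset Printing Implicit Defensive.

Import Order.TTheory GRing.Theory Num.Theory.
Import numFieldNormedType.Exports.

Local Open Scope classical_set_scope.
Local Open Scope ring_scope.

Section Euclidean.
Context {R : realType}.

(* The library norm on matrices is the sup norm, hence the following. *)
Definition enorm n (x : 'cV[R]_n) : R := Num.sqrt (\sum_i x i 0 ^+ 2).

Definition opnorm n k (s : 'M[R]_(n, k)) : R :=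
  sup [set enorm (s *m v) | v in [set v : 'cV[R]_k | enorm v <= 1]].

Definition qform n (P : 'M[R]_n) (x : 'cV[R]_n) : R := (x^T *m P *m x) 0 0.

Definition symmetric_mx n (P : 'M[R]_n) : Prop := P^T = P.

Definition posdef n (P : 'M[R]_n) : Prop :=
  symmetric_mx P /\ forall x : 'cV[R]_n, x != 0 -> 0 < qform P x.

Definition loewner_le n (P Q : 'M[R]_n) : Prop :=
  forall x : 'cV[R]_n, qform P x <= qform Q x.

Definition loewner_itv n (P Q : 'M[R]_n) : set 'M[R]_n :=
  [set X | [/\ symmetric_mx X, loewner_le P X & loewner_le X Q]].

End Euclidean.

Record switched_data (R : realType) (M n k : nat) := SwitchedData {
  gam : R;
  Amx : 'I_M -> 'M[R]_n;
  sig : 'I_M -> 'M[R]_(n, k);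
  Dmx : 'I_M -> 'M[R]_n }.

Section Problem.
Context {R : realType} {M n k : nat}.
Variable d : switched_data R M n k.

Local Notation mu := (@lebesgue_measure R).
Local Notation state := 'cV[R]_n.

Definition assumption_A1 (cA csig cD : R) : Prop :=
  [/\ [/\ 0 < cA, 0 < csig & 0 < cD],
      forall (m : 'I_M) (x : state), qform (Amx d m) x <= - cA * enorm x ^+ 2,
      forall m : 'I_M, opnorm (sig d m) <= csig,
      forall m : 'I_M, posdef (Dmx d m) /\
        forall x : state, qform (Dmx d m) x <= cD * enorm x ^+ 2 &
      cD * csig ^+ 2 / gam d ^+ 2 < cA ^+ 2].

Definition assumption_A2 (cA csig cD mD : R) : Prop :=
  [/\ 0 < mD,
      forall (m : 'I_M) (x : state), mD * enorm x ^+ 2 <= qform (Dmx d m) x &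
      (cA - Num.sqrt (cA ^+ 2 - cD * csig ^+ 2 / gam d ^+ 2)) ^+ 2
        < csig ^+ 2 / gam d ^+ 2 * mD].

Definition lambda1 (cA csig cD : R) : R :=
  gam d ^+ 2 * (cA - Num.sqrt (cA ^+ 2 - cD * csig ^+ 2 / gam d ^+ 2))
    / csig ^+ 2.

Definition lambda2 (csig mD : R) : R := Num.sqrt (mD * gam d ^+ 2 / csig ^+ 2).

(* Disturbances and switching signals are total functions whose values outside
   [0, +oo[, resp. [0, T[, are irrelevant. *)
Definition disturbance : set (R -> 'cV[R]_k) :=
  [set w : R -> 'cV[R]_k | (forall i, measurable_fun (`[0, +oo[ : set R) (fun t : R => w t i 0)) /\
           forall T : R,
             (\int[mu]_(t in `[0%R, T]) (enorm (w t) ^+ 2)%:E < +oo)%E].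

Definition switching (T : R) : set (R -> 'I_M) :=
  [set s : R -> 'I_M | forall m : 'I_M, measurable (`[0, T[ `&` s @^-1` [set m])].

(* Caratheodory solution on [0, T]: the signals are merely measurable, so the
   differential equation is read in integral form. *)
Definition trajectory (x : state) (T : R) (w : R -> 'cV[R]_k) (s : R -> 'I_M)
    (xi : R -> state) : Prop :=
  let rhs i t := (Amx d (s t) *m xi t + sig d (s t) *m w t) i 0 in
  forall i, mu.-integrable `[0, T] (EFin \o rhs i) /\
    forall t : R, 0 <= t <= T ->
      xi t i 0 = x i 0 + \int[mu]_(u in `[0, t]) rhs i u.

(* The terminal cost is extended-real valued so that the semigroups below can
   be iterated without presupposing that the suprema are finite. *)
Definition payoff (T : R) (V : state -> \bar R) (w : R -> 'cV[R]_k)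
    (s : R -> 'I_M) (xi : R -> state) : \bar R :=
  let running : R := \int[mu]_(t in `[0, T])
    (2^-1 * qform (Dmx d (s t)) (xi t) - gam d ^+ 2 / 2 * enorm (w t) ^+ 2) in
  (running%:E + V (xi T))%E.

Definition semigroup (T : R) (V : state -> \bar R) (x : state) : \bar R :=
  ereal_sup [set v | exists w s xi,
    [/\ disturbance w, switching T s, trajectory x T w s xi &
        v = payoff T V w s xi]].

Definition semigroup_mode (m : 'I_M) (T : R) (V : state -> \bar R) (x : state) :
    \bar R :=
  ereal_sup [set v | exists w xi,
    [/\ disturbance w, trajectory x T w (cst m) xi &
        v = payoff T V w (cst m) xi]].

Definition Sigma_mx (m : 'I_M) : 'M[R]_n :=
  (gam d ^+ 2)^-1 *: (sig d m *m (sig d m)^T).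

Definition riccati_rhs (m : 'I_M) (P : 'M[R]_n) : 'M[R]_n :=
  (Amx d m)^T *m P + P *m Amx d m + P *m Sigma_mx m *m P + Dmx d m.

(* Solution on [0, T[, differentiable on the interior and continuous up to 0
   (hence with the right derivative prescribed by the equation at 0). *)
Definition riccati_solution (m : 'I_M) (P0 : 'M[R]_n) (T : \bar R)
    (P : R -> 'M[R]_n) : Prop :=
  [/\ P 0 = P0,
      forall t : R, 0 <= t -> (t%:E < T)%E -> symmetric_mx (P t),
      forall i j, (fun t : R => P t i j) @ 0^'+ --> P0 i j &
      forall t : R, 0 < t -> (t%:E < T)%E ->
        forall i j, is_derive t 1 (fun u : R => P u i j) (riccati_rhs m (P t) i j)].

Definition maximal_riccati_solution (m : 'I_M) (P0 : 'M[R]_n) (T : \bar R)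
    (P : R -> 'M[R]_n) : Prop :=
  [/\ (0 < T)%E, riccati_solution m P0 T P &
      forall T' P', riccati_solution m P0 T' P' -> (T' <= T)%E].

(* [riccati_flow m t P0 Q] is M^m_t[P0] = Q; in particular the flow is defined
   at time t. *)
Definition riccati_flow (m : 'I_M) (t : R) (P0 Q : 'M[R]_n) : Prop :=
  exists T P, [/\ maximal_riccati_solution m P0 T P, 0 <= t,
                  (t%:E < T)%E & P t = Q].

End Problem.

Section Pruning.
Context {R : realType} {n : nat}.

Definition quadratic (P : 'M[R]_n) (x : 'cV[R]_n) : \bar R :=
  (2^-1 * qform P x)%:E.

Definition is_quadratic (f : 'cV[R]_n -> \bar R) : Prop :=
  exists P, symmetric_mx P /\ f = quadratic P.

Record family := Family {
  idx : finType;
  fam :> idx -> 'cV[R]_n -> \bar R }.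

Definition fsup (F : family) (x : 'cV[R]_n) : \bar R :=
  ereal_sup (range (fun i => F i x)).

(* A pruning operation selects indices; it may depend on the family and not
   only on its supremum. *)
Definition pruning := forall F : family, {set idx F}.

Definition prune (p : pruning) (F : family) : family :=
  @Family {i : idx F | i \in p F} (fun i => F (val i)).

(* The bound fsup F <= (1 + c) * fsup (prune F) cannot hold where fsup F < 0:
   already for a family with one negative quadratic function it excludes every
   pruning operation. It is thus required of nonnegative quadratic functions. *)
Definition pruning_error (p : R -> pruning) (r : R) : Prop :=
  exists2 L : R, 0 < L &
    forall (tau : R) (F : family), 0 < tau ->
      (forall i, is_quadratic (F i)) -> (forall i x, (0 <= F i x)%E) ->
      forall x, (fsup (prune (p tau) F) x <= fsup F x)%E /\
        (fsup F x <= (1 + L * tau `^ r)%:E * fsup (prune (p tau) F) x)%E.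

Definition semigroup_family {M k : nat} (d : switched_data R M n k) (tau : R)
    (F : family) : family :=
  @Family ('I_M * idx F)%type
    (fun mj => semigroup_mode d mj.1 tau (F mj.2)).

Definition pruned_iteration {M k : nat} (d : switched_data R M n k)
    (p : R -> pruning) (tau : R) (N : nat) (V : 'cV[R]_n -> \bar R) :
    'cV[R]_n -> \bar R :=
  fsup (iter N (fun F => prune (p tau) (semigroup_family d tau F))
    (@Family unit (fun _ => V))).

End Pruning.

Arguments family R n : clear implicits.
Arguments pruning R n : clear implicits.

(* Main.v *)
(* The pruned iterates V_j are finite maxima of quadratic forms x'Px/2 with P in
   [eps I, lam I].  For delta = K tau^min(1, r-1), backward induction along an
   arbitrary trajectory xi on [0, T], T = N tau, gives
     int_{T - j tau}^T (running cost) + (1 + delta) V_0(xi_T)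
       <= (1 + delta) V_j(xi_{T - j tau}),
   and j = N is the theorem.
   One step: completing the square around the feedback law gamma^-2 sigma' P xi
   frozen at the beginning of a step of length h, the cost of the step is
   1/2 xi' (P + h Phi_m(P)) xi + O(h^2) |xi|^2 for the best mode m, whatever the
   switching; the deviation of w from the feedback only enters through its L^2
   norm, which the term - gamma^2 / 2 |w|^2 absorbs.
   Contraction: Phi_m((1 + delta) P) = (1 + delta) Phi_m(P)
     + delta ((1 + delta) P Sigma^m P - D^m), and the last bracket is negative
   definite because lam < lambda_2; the resulting gain of order delta tau beats
   the errors O(tau^2) of the step and O(tau^r) of the pruning.
   The same one-step estimate, on finer and finer subdivisions of [0, tau],
   shows S^m_tau[x'Px/2] = x'M^m_tau[P]x/2 for small tau without a chain rule for
   absolutely continuous functions; the optimal trajectory comes from a linear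
   differential equation solved by Picard iteration. *)

Require Import Defs.
From HB Require Import structures.
From mathcomp Require Import all_boot all_order all_algebra.
From mathcomp Require Import all_classical all_reals all_analysis.
From mathcomp Require Import measurable_realfun ring lra.

Set Implicit Arguments.
Unset Strict Implicit.
Unset Printing Implicit Defensive.

Import Order.TTheory GRing.Theory Num.Theory.
Import numFieldNormedType.Exports.

Local Open Scope classical_set_scope.
Local Open Scope ring_scope.

(** * Vectors and matrices: l1 norm, bilinear forms, entrywise bounds *)

Definition l1norm (R : realType) n (x : 'cV[R]_n) : R := \sum_i `|x i 0|.

(** Polarised and possibly rectangular version of [qform]; the squared Euclidean norm is the case
    [A = 1%:M], so quadratic expressions expand by bilinearity and are then closed by [ring] or
    [lra]. *)
Definition bform (R : realType) n m (u : 'cV[R]_n) (A : 'M[R]_(n, m))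
  (v : 'cV[R]_m) : R := (u^T *m A *m v) 0 0.

(** Entrywise bounds go with the l1 norm: sums, products and bilinear forms get explicit constants,
    and integrals are estimated coordinate by coordinate, without vector-valued integration. *)
Definition mxbounded (R : realType) n m (A : 'M[R]_(n, m)) (c : R) :=
  forall i j, `|A i j| <= c.

Section LinearAlgebra.
Context {R : realType}.

Lemma l1norm_ge0 n (x : 'cV[R]_n) : 0 <= l1norm x.
Proof. by apply: sumr_ge0 => i _. Qed.

Lemma l1normD n (x y : 'cV[R]_n) : l1norm (x + y) <= l1norm x + l1norm y.
Proof.
by rewrite -big_split; apply: ler_sum => i _; rewrite mxE ler_normD.
Qed.

Lemma l1normZ n c (x : 'cV[R]_n) : l1norm (c *: x) = `|c| * l1norm x.
Proof. by rewrite mulr_sumr; apply: eq_bigr => i _; rewrite mxE normrM. Qed.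

Lemma le_l1norm n (x : 'cV[R]_n) i : `|x i 0| <= l1norm x.
Proof. by rewrite /l1norm (bigD1 i)//= lerDl sumr_ge0. Qed.

Lemma normr_sum_ord_le n (F : 'I_n -> R) c :
  (forall i, `|F i| <= c) -> `|\sum_i F i| <= n%:R * c.
Proof.
move=> Fc; rewrite (le_trans (ler_norm_sum _ _ _))//.
rewrite mulr_natl -[n in _ *+ n]card_ord -sumr_const.
exact: ler_sum.
Qed.

Lemma l1norm_mulmx n m (A : 'M[R]_(n, m)) x c :
  mxbounded A c -> l1norm (A *m x) <= n%:R * c * l1norm x.
Proof.
move=> Ac; rewrite -mulrA mulr_natl -[n in _ *+ n]card_ord -sumr_const.
apply: ler_sum => i _; rewrite mxE mulr_sumr.
apply: le_trans (ler_norm_sum _ _ _) _; apply: ler_sum => j _.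
by rewrite normrM ler_wpM2r.
Qed.

Lemma bform_sum n m (u : 'cV[R]_n) (A : 'M[R]_(n, m)) v :
  bform u A v = \sum_i u i 0 * (A *m v) i 0.
Proof.
by rewrite /bform -mulmxA mxE; apply: eq_bigr => i _; rewrite mxE.
Qed.

Lemma bform_bound n m (u : 'cV[R]_n) (A : 'M[R]_(n, m)) v c :
  mxbounded A c -> `|bform u A v| <= c * l1norm u * l1norm v.
Proof.
move=> Ac; rewrite bform_sum (le_trans (ler_norm_sum _ _ _))//.
rewrite mulrAC mulr_sumr; apply: ler_sum => i _.
rewrite normrM mulrC ler_wpM2r// mxE mulr_sumr.
apply: le_trans (ler_norm_sum _ _ _) _; apply: ler_sum => j _.
by rewrite normrM ler_wpM2r.
Qed.

Lemma bformDl n m u u' (A : 'M[R]_(n, m)) v :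
  bform (u + u') A v = bform u A v + bform u' A v.
Proof. by rewrite /bform linearD /= !mulmxDl mxE. Qed.

Lemma bformDr n m u (A : 'M[R]_(n, m)) v v' :
  bform u A (v + v') = bform u A v + bform u A v'.
Proof. by rewrite /bform mulmxDr mxE. Qed.

Lemma bformDm n m u (A B : 'M[R]_(n, m)) v :
  bform u (A + B) v = bform u A v + bform u B v.
Proof. by rewrite /bform mulmxDr mulmxDl mxE. Qed.

Lemma bformNm n m u (A : 'M[R]_(n, m)) v : bform u (- A) v = - bform u A v.
Proof. by rewrite /bform mulmxN mulNmx mxE. Qed.

Lemma bformZm n m c u (A : 'M[R]_(n, m)) v :
  bform u (c *: A) v = c * bform u A v.
Proof. by rewrite /bform -scalemxAr -scalemxAl mxE. Qed.

Lemma bformZl n m c u (A : 'M[R]_(n, m)) v :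
  bform (c *: u) A v = c * bform u A v.
Proof. by rewrite /bform linearZ /= -!scalemxAl mxE. Qed.

Lemma bformZr n m c u (A : 'M[R]_(n, m)) v :
  bform u A (c *: v) = c * bform u A v.
Proof. by rewrite /bform -scalemxAr mxE. Qed.

Lemma bform_mulr n m p u (A : 'M[R]_(n, m)) (B : 'M[R]_(m, p)) v :
  bform u A (B *m v) = bform u (A *m B) v.
Proof. by rewrite /bform !mulmxA. Qed.

Lemma bform_mull n m p u (A : 'M[R]_(n, m)) (B : 'M[R]_(n, p)) v :
  bform (B *m u) A v = bform u (B^T *m A) v.
Proof. by rewrite /bform trmx_mul !mulmxA. Qed.

Lemma bformC n m u (A : 'M[R]_(n, m)) v : bform u A v = bform v A^T u.
Proof.
rewrite /bform -[LHS](mxE trmx_key (fun i j => (u^T *m A *m v) j i)).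
by rewrite -/(trmx _) !trmx_mul trmxK mulmxA.
Qed.

Lemma qformE n (P : 'M[R]_n) x : qform P x = bform x P x.
Proof. by []. Qed.

Lemma enorm_sqr_sum n (x : 'cV[R]_n) : enorm x ^+ 2 = \sum_i x i 0 ^+ 2.
Proof. by rewrite sqr_sqrtr// sumr_ge0// => i _; rewrite sqr_ge0. Qed.

Lemma enorm_sqr n (x : 'cV[R]_n) : enorm x ^+ 2 = bform x 1%:M x.
Proof.
rewrite enorm_sqr_sum bform_sum mul1mx.
by apply: eq_bigr => i _; rewrite expr2.
Qed.

Lemma enorm_ge0 n (x : 'cV[R]_n) : 0 <= enorm x.
Proof. exact: sqrtr_ge0. Qed.

Lemma enorm_sqrD n (x y : 'cV[R]_n) :
  enorm (x + y) ^+ 2 = enorm x ^+ 2 + 2 * bform x 1%:M y + enorm y ^+ 2.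
Proof.
rewrite !enorm_sqr !bformDl !bformDr (bformC y) trmx1; ring.
Qed.

Lemma enorm_sqrN n (x : 'cV[R]_n) : enorm (- x) ^+ 2 = enorm x ^+ 2.
Proof.
by rewrite !enorm_sqr_sum; apply: eq_bigr => i _; rewrite mxE sqrrN.
Qed.

Lemma enorm_sqrB_le n (x y : 'cV[R]_n) :
  enorm (x - y) ^+ 2 <= 2 * enorm x ^+ 2 + 2 * enorm y ^+ 2.
Proof.
have := sqr_ge0 (enorm (x + y)); rewrite !enorm_sqrD enorm_sqrN.
rewrite -[- y]scaleN1r bformZr; lra.
Qed.

(** Symmetrisation: both sides become double sums, and [|x_i| |x_j|] is at most the mean of the two
    squares. *)
Lemma l1norm_sqr n (x : 'cV[R]_n) : l1norm x ^+ 2 <= n%:R * enorm x ^+ 2.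
Proof.
rewrite enorm_sqr_sum expr2 {1}/l1norm mulr_suml.
have -> : n%:R * (\sum_i x i 0 ^+ 2) =
    \sum_(i < n) \sum_(j < n) 2^-1 * (x i 0 ^+ 2 + x j 0 ^+ 2).
  under [RHS]eq_bigr do rewrite -mulr_sumr big_split/= sumr_const card_ord.
  rewrite -mulr_sumr big_split /= sumr_const card_ord sumrMnl.
  by rewrite mulr_natl -mulr2n -[X in _ * X]mulr_natl mulKf// pnatr_eq0.
apply: ler_sum => i _; rewrite /l1norm mulr_sumr; apply: ler_sum => j _.
rewrite -[x i 0 ^+ 2]real_normK ?num_real// -[x j 0 ^+ 2]real_normK ?num_real//.
have := sqr_ge0 (`|x i 0| - `|x j 0|); lra.
Qed.

Lemma enorm_le_l1norm n (x : 'cV[R]_n) : enorm x ^+ 2 <= l1norm x ^+ 2.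
Proof.
rewrite enorm_sqr_sum expr2 {1}/l1norm mulr_suml; apply: ler_sum => i _.
by rewrite -[x i 0 ^+ 2]real_normK ?num_real// expr2 ler_wpM2l// le_l1norm.
Qed.

Lemma mxboundedD n m (A B : 'M[R]_(n, m)) a b :
  mxbounded A a -> mxbounded B b -> mxbounded (A + B) (a + b).
Proof.
by move=> Aa Bb i j; rewrite mxE (le_trans (ler_normD _ _))// lerD.
Qed.

Lemma mxboundedZ n m (A : 'M[R]_(n, m)) a c :
  mxbounded A a -> mxbounded (c *: A) (`|c| * a).
Proof. by move=> Aa i j; rewrite mxE normrM ler_wpM2l. Qed.

Lemma mxboundedM n m p (A : 'M[R]_(n, m)) (B : 'M[R]_(m, p)) a b :
  mxbounded A a -> mxbounded B b -> mxbounded (A *m B) (m%:R * (a * b)).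
Proof.
move=> Aa Bb i j; rewrite mxE.
by apply: normr_sum_ord_le => l; rewrite normrM ler_pM.
Qed.

Lemma mxbounded_tr n m (A : 'M[R]_(n, m)) a :
  mxbounded A a -> mxbounded A^T a.
Proof. by move=> Aa i j; rewrite mxE. Qed.

Lemma mxbounded_le n m (A : 'M[R]_(n, m)) a b :
  mxbounded A a -> a <= b -> mxbounded A b.
Proof. by move=> Aa ab i j; exact: le_trans ab. Qed.

Lemma mxbounded_ex n m (I : finType) (A : I -> 'M[R]_(n, m)) :
  exists2 c : R, 0 <= c & forall i, mxbounded (A i) c.
Proof.
exists (\sum_i \sum_p `|A i p.1 p.2|).
  by apply: sumr_ge0 => i _; apply: sumr_ge0.
move=> i p q.
rewrite (bigD1 i)//= (bigD1 (p, q))//=.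
by rewrite -addrA lerDl addr_ge0// sumr_ge0// => j _; rewrite sumr_ge0.
Qed.

End LinearAlgebra.

(** * Integrals on compact intervals *)

Definition itv_integrable (R : realType) (a b : R) (f : R -> R) : Prop :=
  (@lebesgue_measure R).-integrable `[a, b] (EFin \o f).

Definition itv_measurable (R : realType) (a b : R) (f : R -> R) : Prop :=
  measurable_fun (`[a, b] : set R) f.

Definition itv_int (R : realType) (a b : R) (f : R -> R) : R :=
  \int[@lebesgue_measure R]_(t in `[a, b]) f t.

Section IntervalIntegrals.
Context {R : realType}.
Implicit Types (a b c t : R) (f g : R -> R).
Local Notation mu := (@lebesgue_measure R).

Lemma sub_itv a b a' b' : a <= a' -> b' <= b -> `[a', b'] `<=` `[a, b].
Proof.
move=> aa bb x /=; rewrite !in_itv/= => /andP[ax xb].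
by rewrite (le_trans aa ax) (le_trans xb bb).
Qed.

Lemma itv_integrableS a b a' b' f : a <= a' -> b' <= b ->
  itv_integrable a b f -> itv_integrable a' b' f.
Proof. by move=> aa bb; apply: integrableS => //; exact: sub_itv. Qed.

Lemma itv_measurableS a b a' b' f : a <= a' -> b' <= b ->
  itv_measurable a b f -> itv_measurable a' b' f.
Proof. by move=> aa bb; apply: measurable_funS => //; exact: sub_itv. Qed.

Lemma eq_itv_integrable a b f g : (forall t, a <= t <= b -> f t = g t) ->
  itv_integrable a b f -> itv_integrable a b g.
Proof.
move=> fg; apply: eq_integrable => // t; rewrite inE/= in_itv/= => tab.
by rewrite fg.
Qed.

Lemma eq_itv_int a b f g : (forall t, a <= t <= b -> f t = g t) ->
  itv_int a b f = itv_int a b g.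
Proof.
move=> fg; apply: eq_Rintegral => // t; rewrite inE/= in_itv/= => tab.
exact: fg.
Qed.

Lemma itv_integrableD a b f g :
  itv_integrable a b f -> itv_integrable a b g ->
  itv_integrable a b (fun t => f t + g t).
Proof.
move=> fi gi; apply: eq_integrable (integrableD _ fi gi) => //.
Qed.

Lemma itv_integrableZ a b k f :
  itv_integrable a b f -> itv_integrable a b (fun t => k * f t).
Proof.
by move=> fi; apply: eq_integrable (integrableZl _ k fi).
Qed.

Lemma itv_integrableN a b f :
  itv_integrable a b f -> itv_integrable a b (fun t => - f t).
Proof.
by move=> fi; apply: eq_integrable (integrableN fi).
Qed.

Lemma itv_integrableB a b f g :
  itv_integrable a b f -> itv_integrable a b g ->
  itv_integrable a b (fun t => f t - g t).
Proof. by move=> fi gi; exact/itv_integrableD/itv_integrableN. Qed.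

Lemma itv_integrable_norm a b f :
  itv_integrable a b f -> itv_integrable a b (fun t => `|f t|).
Proof. by move=> fi; apply: eq_integrable (integrable_norm fi). Qed.

Lemma itv_integrable_cst a b k : itv_integrable a b (cst k).
Proof.
apply/integrableP; split; first exact/measurable_EFinP.
rewrite /= integral_cst//= lebesgue_measure_itv; case: ifP => _.
  by rewrite -EFinD -EFinM ltry.
by rewrite mule0 ltry.
Qed.

Lemma itv_integrable_le a b f g : itv_measurable a b f ->
  (forall t, a <= t <= b -> `|f t| <= g t) ->
  itv_integrable a b g -> itv_integrable a b f.
Proof.
move=> mf fg; apply: le_integrable => //; first exact/measurable_EFinP.
move=> t /=; rewrite in_itv/= => /fg h.
by rewrite lee_fin (le_trans h)// ler_norm.
Qed.

Lemma itv_integrable_bounded a b f c : itv_measurable a b f ->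
  (forall t, a <= t <= b -> `|f t| <= c) -> itv_integrable a b f.
Proof. by move=> mf fc; apply: itv_integrable_le (itv_integrable_cst a b c). Qed.

Lemma itv_intD a b f g : itv_integrable a b f -> itv_integrable a b g ->
  itv_int a b (fun t => f t + g t) = itv_int a b f + itv_int a b g.
Proof. by move=> fi gi; rewrite /itv_int RintegralD. Qed.

Lemma itv_intB a b f g : itv_integrable a b f -> itv_integrable a b g ->
  itv_int a b (fun t => f t - g t) = itv_int a b f - itv_int a b g.
Proof. by move=> fi gi; rewrite /itv_int RintegralB. Qed.

Lemma itv_intZ a b k f : itv_integrable a b f ->
  itv_int a b (fun t => k * f t) = k * itv_int a b f.
Proof. by move=> fi; rewrite /itv_int RintegralZl. Qed.

Lemma itv_int_cst a b k : a <= b -> itv_int a b (cst k) = k * (b - a).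
Proof.
move=> ab; rewrite /itv_int Rintegral_cst//; congr (_ * _).
rewrite /= lebesgue_measure_itv/= lte_fin; case: ltP => //= ba.
by apply/eqP; rewrite eq_sym subr_eq0 eq_le ab ba.
Qed.

Lemma itv_int_sum a b (I : Type) (s : seq I) (F : I -> R -> R) :
  (forall i, itv_integrable a b (F i)) ->
  itv_integrable a b (fun t => \sum_(i <- s) F i t) /\
  itv_int a b (fun t => \sum_(i <- s) F i t) = \sum_(i <- s) itv_int a b (F i).
Proof.
move=> Fi; elim: s => [|i s [ih1 ih2]].
  split; first by under eq_fun do rewrite big_nil; exact: itv_integrable_cst.
  rewrite big_nil (@eq_itv_int _ _ _ (fun=> 0)); last first.
    by move=> t _; rewrite big_nil.
  by rewrite /itv_int Rintegral_cst// mul0r.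
split; first by under eq_fun do rewrite big_cons; exact: itv_integrableD.
rewrite big_cons -ih2 -itv_intD//.
by apply: eq_itv_int => t _; rewrite big_cons.
Qed.

Lemma le_itv_int a b f g : itv_integrable a b f -> itv_integrable a b g ->
  (forall t, a <= t <= b -> f t <= g t) -> itv_int a b f <= itv_int a b g.
Proof.
move=> fi gi fg; apply: le_Rintegral => // t /=; rewrite in_itv/=; exact: fg.
Qed.

Lemma itv_int_ge0 a b f : (forall t, a <= t <= b -> 0 <= f t) ->
  0 <= itv_int a b f.
Proof.
by move=> f0; apply: Rintegral_ge0 => t /=; rewrite in_itv/=; exact: f0.
Qed.

Lemma normr_itv_int a b f : itv_integrable a b f ->
  `|itv_int a b f| <= itv_int a b (fun t => `|f t|).
Proof. by move=> fi; exact: le_normr_Rintegral. Qed.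

Lemma itv_int_norm_bound a b f c : a <= b -> itv_integrable a b f ->
  (forall t, a <= t <= b -> `|f t| <= c) -> `|itv_int a b f| <= c * (b - a).
Proof.
move=> ab fi fc; rewrite (le_trans (normr_itv_int fi))// -itv_int_cst//.
apply: le_itv_int => //; first exact: itv_integrable_norm.
exact: itv_integrable_cst.
Qed.

Lemma itv_int_split a b c f : a <= b <= c -> itv_integrable a c f ->
  itv_int a c f = itv_int a b f + itv_int b c f.
Proof.
move=> /andP[ab bc] fi; have := @Rintegral_itvB R f (BLeft a) (BRight c) b fi.
rewrite !bnd_simp => /(_ ab bc) e.
(* The second piece comes out open at [b]; closing it adds a null set. *)
rewrite Rintegral_itv_obnd_cbnd in e; last first.
  by apply: integrableS fi => //; apply: subset_itvr; rewrite bnd_simp.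
by rewrite /itv_int -e; lra.
Qed.

Lemma itv_int_point a f : itv_int a a f = 0.
Proof. by rewrite /itv_int set_itv1 Rintegral_set1. Qed.

(* Cauchy--Schwarz: expand the integral of [(f - F / h) ^+ 2]. *)
Lemma itv_int_sqr_le a b f : a <= b -> itv_integrable a b f ->
  itv_integrable a b (fun t => f t ^+ 2) ->
  itv_int a b f ^+ 2 <= (b - a) * itv_int a b (fun t => f t ^+ 2).
Proof.
rewrite le_eqVlt => /predU1P[->|ab] fi f2i.
  by rewrite !itv_int_point subrr mul0r expr0n.
set F := itv_int a b f; set h := b - a.
have h0 : 0 < h by rewrite subr_gt0.
have i1 : itv_integrable a b (fun t => 2 * (F / h) * f t).
  exact: itv_integrableZ.
have i2 := itv_integrableB f2i i1.
have i3 := itv_integrable_cst a b ((F / h) ^+ 2).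
have : 0 <= itv_int a b (fun t => f t ^+ 2 - 2 * (F / h) * f t + cst ((F / h) ^+ 2) t).
  apply: itv_int_ge0 => t _ /=.
  suff -> : f t ^+ 2 - 2 * (F / h) * f t + (F / h) ^+ 2 = (f t - F / h) ^+ 2.
    exact: sqr_ge0.
  ring.
rewrite itv_intD// itv_intB// itv_intZ// (itv_int_cst _ (ltW ab)) -/F -/h.
set E := itv_int _ _ _.

have -> : E - 2 * (F / h) * F + (F / h) ^+ 2 * h = h^-1 * (h * E - F ^+ 2).
  by field; rewrite gt_eqF.
by rewrite pmulr_rge0 ?invr_gt0// subr_ge0.
Qed.

Lemma itv_measurableD a b f g : itv_measurable a b f -> itv_measurable a b g ->
  itv_measurable a b (fun t => f t + g t).
Proof. exact: measurable_funD. Qed.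

Lemma itv_measurableM a b f g : itv_measurable a b f -> itv_measurable a b g ->
  itv_measurable a b (fun t => f t * g t).
Proof. exact: measurable_funM. Qed.

Lemma itv_measurable_cst a b k : itv_measurable a b (cst k).
Proof. exact: measurable_cst. Qed.

Lemma itv_measurable_sum a b (I : Type) (s : seq I) (F : I -> R -> R) :
  (forall i, itv_measurable a b (F i)) ->
  itv_measurable a b (fun t => \sum_(i <- s) F i t).
Proof. by move=> mF; exact: measurable_sum. Qed.

Lemma eq_itv_measurable a b f g : (forall t, a <= t <= b -> f t = g t) ->
  itv_measurable a b f -> itv_measurable a b g.
Proof.
move=> fg; apply: eq_measurable_fun => t; rewrite inE/= in_itv/=; exact: fg.
Qed.

(** The preimage of a measurable set is a finite union, over the modes, of pieces on which the
    signal is constant. All measurability along a switching signal reduces to frozen modes this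
    way. *)
Lemma itv_measurable_switch a b (I : finType) (s : R -> I) (F : I -> R -> R) :
  (forall i, measurable (`[a, b] `&` s @^-1` [set i])) ->
  (forall i, itv_measurable a b (F i)) ->
  itv_measurable a b (fun t => F (s t) t).
Proof.
move=> ms mF _ Y mY.
have -> : `[a, b] `&` (fun t => F (s t) t) @^-1` Y =
    \bigcup_i ((`[a, b] `&` s @^-1` [set i]) `&` (`[a, b] `&` F i @^-1` Y)).
  apply/seteqP; split=> t /=.
    by move=> [tab Yt]; exists (s t).
  by move=> [i _ [[tab <-] [_ Yt]]].
apply: fin_bigcup_measurable => //.
by move=> i _; apply: measurableI => //; exact: mF.
Qed.

Lemma itv_measurable_int a b f : a <= b -> itv_integrable a b f ->
  itv_measurable a b (fun t => itv_int a t f).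
Proof.
move=> ab fi; apply: subspace_continuous_measurable_fun => //.
exact: parameterized_integral_continuous.
Qed.

End IntervalIntegrals.

(** * The one-step estimate *)

Section OneStep.
Context {R : realType} {M n k : nat}.
Variable d : switched_data R M n k.
Local Notation state := 'cV[R]_n.

Definition running_cost (w : R -> 'cV[R]_k) (s : R -> 'I_M) (xi : R -> state)
    (t : R) : R :=
  2^-1 * qform (Dmx d (s t)) (xi t) - gam d ^+ 2 / 2 * enorm (w t) ^+ 2.

Definition velocity (w : R -> 'cV[R]_k) (s : R -> 'I_M) (xi : R -> state)
    (t : R) : state :=
  Amx d (s t) *m xi t + sig d (s t) *m w t.

(** The maximiser over [w] of [y' P sig w - gam^2 / 2 |w|^2], that is, the optimal disturbance at
    [y] when the value function is [x' P x / 2]. *)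
Definition feedback (m : 'I_M) (P : 'M[R]_n) (y : state) : 'cV[R]_k :=
  (gam d ^+ 2)^-1 *: ((sig d m)^T *m (P *m y)).

(** The initial value is [xi a] itself, so the notion restricts to subintervals; a long trajectory
    is then estimated step by step. *)
Definition trajectory_on (a b : R) (w : R -> 'cV[R]_k) (s : R -> 'I_M)
    (xi : R -> state) : Prop :=
  [/\ forall m, measurable (`[a, b] `&` s @^-1` [set m]),
      forall i, itv_measurable a b (fun t => w t i 0),
      itv_integrable a b (fun t => enorm (w t) ^+ 2),
      forall i, itv_integrable a b (fun t => velocity w s xi t i 0) &
      forall t i, a <= t <= b ->
        xi t i 0 = xi a i 0 + itv_int a t (fun u => velocity w s xi u i 0)].

Lemma trajectory_onS a b a' b' w s xi : a <= a' -> a' <= b' -> b' <= b ->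
  trajectory_on a b w s xi -> trajectory_on a' b' w s xi.
Proof.
move=> aa ab bb [ms mw w2 vi xiE]; split.
- move=> m; have -> : `[a', b'] `&` s @^-1` [set m] =
    `[a', b'] `&` (`[a, b] `&` s @^-1` [set m]).
    by rewrite setIA; congr (_ `&` _); apply/esym/setIidl; exact: sub_itv.
  exact: measurableI.
- by move=> i; exact: itv_measurableS (mw i).
- exact: itv_integrableS w2.
- by move=> i; exact: itv_integrableS (vi i).
- move=> t i /andP[at' tb].
  rewrite (xiE t) ?(le_trans aa at') ?(le_trans tb bb)//.
  rewrite (xiE a') ?aa ?(le_trans ab bb)// -addrA; congr (_ + _).
  apply: itv_int_split; first by rewrite aa at'.
  by apply: itv_integrableS (vi i) => //; exact: le_trans bb.
Qed.

(** Here [y] is the state frozen at the start of a step and [D] the displacement since then. The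
    left factor of the [P] term is kept at [y], so that this term is linear in the velocity and
    integrates exactly. Completing the square in [w] leaves the Riccati right-hand side at [y],
    terms containing [D], and a nonpositive square. *)
Lemma running_cost_completion m (P : 'M[R]_n) (y D : state) (w : 'cV[R]_k) :
  0 < gam d -> symmetric_mx (Dmx d m) -> symmetric_mx P ->
  2^-1 * qform (Dmx d m) (y + D) - gam d ^+ 2 / 2 * enorm w ^+ 2
    + bform y P (Amx d m *m (y + D) + sig d m *m w) =
  2^-1 * qform (riccati_rhs d m P) y
    + (bform y (Dmx d m + P *m Amx d m) D + 2^-1 * qform (Dmx d m) D)
    - gam d ^+ 2 / 2 * enorm (w - feedback m P y) ^+ 2.
Proof.
move=> g0 sD sP; set e := w - feedback m P y.
have -> : w = e + feedback m P y by rewrite subrK.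
set f := feedback m P y; set A := Amx d m; set S := sig d m.
(* The feedback is the vector that represents [v |-> y' P sig v], up to [gam^2]; hence the terms
   linear in the deviation [e] cancel. *)
have fE (v : 'cV[R]_k) : bform y P (S *m v) = gam d ^+ 2 * bform v 1%:M f.
  rewrite /f /feedback bformZr mulrA mulfV ?mul1r ?sqrf_eq0 ?gt_eqF//.
  by rewrite bform_mulr (bformC v) trmx1 !bform_mull trmxK mulmx1 sP.
have ff : enorm f ^+ 2 = (gam d ^+ 2)^-1 * qform (P *m Sigma_mx d m *m P) y.
  rewrite enorm_sqr; apply: (mulfI (x := gam d ^+ 2)).
    by rewrite sqrf_eq0 gt_eqF.
  rewrite -fE mulrA mulfV ?mul1r ?sqrf_eq0 ?gt_eqF// qformE.
  rewrite /f /feedback -scalemxAr bformZr /Sigma_mx -scalemxAr -scalemxAl.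
  by rewrite bformZm !bform_mulr !mulmxA.
rewrite enorm_sqrD ff.
rewrite !mulmxDr !bformDr !fE -enorm_sqr ff /riccati_rhs !qformE -/A.
rewrite !bformDl !bformDr !bformDm (bformC D) sD !bform_mulr.
have -> : bform y (A^T *m P) y = bform y (P *m A) y.
  by rewrite bformC trmx_mul trmxK sP.
field; rewrite ?gt_eqF//.
Qed.

End OneStep.

Section OneStepEstimate.
Context {R : realType} {M n k : nat}.
Variable d : switched_data R M n k.
Local Notation state := 'cV[R]_n.

Lemma trajectory_on_measurable a b w s (xi : R -> state) i :
  a <= b -> trajectory_on d a b w s xi -> itv_measurable a b (fun t => xi t i 0).
Proof.
move=> ab [_ _ _ vi xiE].
apply: (@eq_itv_measurable _ _ _ (fun t => xi a i 0 +
    itv_int a t (fun u => velocity d w s xi u i 0))).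
  by move=> t tab; rewrite (xiE t).
by apply: itv_measurableD; [exact: itv_measurable_cst|exact: itv_measurable_int].
Qed.

Lemma itv_measurable_mulmx a b m p (A : 'M[R]_(m, p)) (f : R -> 'cV[R]_p) :
  (forall i, itv_measurable a b (fun t => f t i 0)) ->
  forall i, itv_measurable a b (fun t => (A *m f t) i 0).
Proof.
move=> mf i; under eq_fun do rewrite mxE.
apply: itv_measurable_sum => j.
by apply: itv_measurableM; [exact: itv_measurable_cst|exact: mf].
Qed.

Lemma itv_measurable_bform a b m p (A : 'M[R]_(m, p))
    (f : R -> 'cV[R]_m) (g : R -> 'cV[R]_p) :
  (forall i, itv_measurable a b (fun t => f t i 0)) ->
  (forall i, itv_measurable a b (fun t => g t i 0)) ->
  itv_measurable a b (fun t => bform (f t) A (g t)).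
Proof.
move=> mf mg; under eq_fun do rewrite bform_sum.
apply: itv_measurable_sum => j.
by apply: itv_measurableM; [exact: mf|exact: itv_measurable_mulmx].
Qed.

Lemma itv_measurable_enorm_sqr a b m (f : R -> 'cV[R]_m) :
  (forall i, itv_measurable a b (fun t => f t i 0)) ->
  itv_measurable a b (fun t => enorm (f t) ^+ 2).
Proof.
by move=> mf; under eq_fun do rewrite enorm_sqr; exact: itv_measurable_bform.
Qed.

Lemma itv_measurable_l1norm a b m (f : R -> 'cV[R]_m) :
  (forall i, itv_measurable a b (fun t => f t i 0)) ->
  itv_measurable a b (fun t => l1norm (f t)).
Proof.
move=> mf; apply: itv_measurable_sum => j.
by apply: measurableT_comp => //; exact: mf.
Qed.

Lemma trajectory_on_of x T w s xi : 0 <= T -> disturbance w -> switching T s ->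
  trajectory d x T w s xi -> trajectory_on d 0 T w s xi /\ xi 0 = x.
Proof.
move=> T0 [mw w2] ms tr.
have x0 : xi 0 = x.
  apply/matrixP => i j; rewrite (ord1 j).
  have [_ /(_ 0)] := tr i; rewrite lexx T0 => ->//.
  by rewrite set_itv1 Rintegral_set1 addr0.
have mwT i : itv_measurable 0 T (fun t => w t i 0).
  apply: measurable_funS (mw i) => //.
  by move=> t /=; rewrite !in_itv/= => /andP[->].
split=> //; split.
(* [switching] speaks of the half-open interval only; the endpoint [T] is added to, or left out of,
   the preimage as a single point. *)
- move=> m; have [sT|sT] := eqVneq (s T) m.
    have -> : `[0, T] `&` s @^-1` [set m] = (`[0, T[ `&` s @^-1` [set m]) `|` [set T].
      apply/seteqP; split=> t /=; rewrite !in_itv/=.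
        move=> [/andP[t0]]; rewrite le_eqVlt => /predU1P[-> _|tT stm]; first by right.
        by left; rewrite t0 tT.
      by move=> [[/andP[-> /ltW ->]]//|->]; rewrite T0 lexx.
    exact: measurableU.
  have -> : `[0, T] `&` s @^-1` [set m] = `[0, T[ `&` s @^-1` [set m].
    apply/seteqP; split=> t /=; rewrite !in_itv/=.
      move=> [/andP[t0]]; rewrite le_eqVlt => /predU1P[->|tT stm].
        by move/eqP: sT.
      by rewrite t0 tT.
    by move=> [/andP[-> /ltW ->]].
  exact: ms.
- exact: mwT.
- apply/integrableP; split.
    by apply/measurable_EFinP; exact: itv_measurable_enorm_sqr.
  apply: le_lt_trans (w2 T).
  by under eq_integral do rewrite /= ger0_norm ?sqr_ge0//.
- by move=> i; have [] := tr i.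
- move=> t i tT; have [_ /(_ t tT) ->] := tr i.
  by rewrite x0.
Qed.

(** With the left argument fixed, the form is a finite combination of coordinates and so commutes
    with the integral. *)
Lemma itv_int_bform a b m p (u : 'cV[R]_m) (A : 'M[R]_(m, p)) (f : R -> 'cV[R]_p)
    (v : 'cV[R]_p) :
  (forall i, itv_integrable a b (fun t => f t i 0)) ->
  (forall i, v i 0 = itv_int a b (fun t => f t i 0)) ->
  itv_integrable a b (fun t => bform u A (f t)) /\
  bform u A v = itv_int a b (fun t => bform u A (f t)).
Proof.
move=> fi vE.
have bE g : bform u A g = \sum_i (u^T *m A) 0 i * g i 0.
  by rewrite /bform mxE.
have [h1 h2] := @itv_int_sum R a b _ (index_enum 'I_p)
  (fun i t => (u^T *m A) 0 i * f t i 0) (fun i => itv_integrableZ _ (fi i)).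
split; first by under eq_fun do rewrite bE.
rewrite bE; transitivity (itv_int a b (fun t => \sum_i (u^T *m A) 0 i * f t i 0)).
  by rewrite h2; apply: eq_bigr => i _; rewrite vE itv_intZ.
by apply: eq_itv_int => t _; rewrite bE.
Qed.

Lemma l1norm_velocity_integrable a b w s (xi : R -> state) :
  trajectory_on d a b w s xi ->
  itv_integrable a b (fun t => l1norm (velocity d w s xi t)).
Proof.
move=> [_ _ _ vi _].
have [h _] := @itv_int_sum R a b _ (index_enum 'I_n)
  (fun i t => `|velocity d w s xi t i 0|) (fun i => itv_integrable_norm (vi i)).
exact: h.
Qed.

Lemma trajectory_on_displacement a b w s (xi : R -> state) t :
  trajectory_on d a b w s xi -> a <= t <= b ->
  l1norm (xi t - xi a) <= itv_int a b (fun t => l1norm (velocity d w s xi t)).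
Proof.
move=> tr /andP[at' tb]; have [_ _ _ vi xiE] := tr.
have vt i : itv_integrable a t (fun t => velocity d w s xi t i 0).
  exact: itv_integrableS (vi i).
apply: (@le_trans _ _ (itv_int a t (fun t => l1norm (velocity d w s xi t)))).
  have [_ ->] := @itv_int_sum R a t _ (index_enum 'I_n)
    (fun i t => `|velocity d w s xi t i 0|) (fun i => itv_integrable_norm (vt i)).
  apply: ler_sum => i _; rewrite !mxE xiE ?at'// addrAC subrr add0r.
  exact: normr_itv_int.
rewrite [leRHS](@itv_int_split _ a t b) ?at'//; last first.
  exact: l1norm_velocity_integrable.
by rewrite lerDl itv_int_ge0// => u _; exact: l1norm_ge0.
Qed.

(** The constant is linear in the bound [p] on [P], so the estimate also makes the feedback of a
    small difference of matrices small. *)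
Lemma l1norm_feedback_le :
  exists2 c : R, 0 <= c & forall m P (y : state) p, mxbounded P p ->
    l1norm (feedback d m P y) <= c * p * l1norm y.
Proof.
have [cS cS0 Sb] := mxbounded_ex (sig d).
have g0 : 0 <= (gam d ^+ 2)^-1 by rewrite invr_ge0 sqr_ge0.
exists ((gam d ^+ 2)^-1 * (k%:R * cS * n%:R)); first by rewrite !mulr_ge0.
move=> m P y p Pb; rewrite /feedback l1normZ ger0_norm// -!mulrA.
rewrite ler_wpM2l// (le_trans (l1norm_mulmx _ (mxbounded_tr (Sb m))))//.
rewrite -!mulrA ler_wpM2l// ler_wpM2l// mulrA.
exact: l1norm_mulmx.
Qed.

Lemma l1norm_feedback_bound (pb : R) : 0 <= pb ->
  exists2 c : R, 0 <= c & forall m P (y : state), mxbounded P pb ->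
    l1norm (feedback d m P y) <= c * l1norm y.
Proof.
move=> pb0; have [c c0 h] := l1norm_feedback_le.
by exists (c * pb) => [|m P y]; [rewrite mulr_ge0|exact: h].
Qed.

Lemma feedback_deviation_measurable a b w s (xi : R -> state) P y i :
  trajectory_on d a b w s xi ->
  itv_measurable a b (fun t => (w t - feedback d (s t) P y) i 0).
Proof.
move=> [ms mw _ _ _].
have mf : itv_measurable a b (fun t => - feedback d (s t) P y i 0).
  apply: (itv_measurable_switch ms
    (F := fun m t => - feedback d m P y i 0)) => m.
  exact: itv_measurable_cst.
rewrite (_ : (fun t => _) = (fun t => w t i 0 + - feedback d (s t) P y i 0)).
  exact: itv_measurableD.
by apply/funext => t; rewrite mxE; congr (_ + _); rewrite mxE.
Qed.

(** The displacement bound makes [xi] bounded, so its quadratic terms are bounded and measurable;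
    the deviation is dominated by [|w|^2] plus a constant. *)
Lemma trajectory_on_integrable (pb a b : R) w s (xi : R -> state) P :
  0 <= pb -> mxbounded P pb -> a <= b ->
  trajectory_on d a b w s xi ->
  [/\ itv_integrable a b (running_cost d w s xi),
      itv_integrable a b (fun t => 2^-1 * qform (riccati_rhs d (s t) P) (xi a)) &
      itv_integrable a b
        (fun t => enorm (w t - feedback d (s t) P (xi a)) ^+ 2)].
Proof.
move=> pb0 Pb ab tr; have [ms mw w2 vi xiE] := tr.
have mxi i := trajectory_on_measurable i ab tr.
have [cD cD0 Db] := mxbounded_ex (Dmx d).
have [cf cf0 fb] := l1norm_feedback_bound pb0.
set Z := itv_int a b (fun t => l1norm (velocity d w s xi t)).
have xib t : a <= t <= b -> l1norm (xi t) <= l1norm (xi a) + Z.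
  move=> tab; have := trajectory_on_displacement tr tab.
  have := l1normD (xi a) (xi t - xi a); rewrite addrC subrK -/Z; lra.
split.
- apply: itv_integrableB; last exact: itv_integrableZ.
  apply: itv_integrableZ.
  apply: (@itv_integrable_bounded _ _ _ _
    (cD * (l1norm (xi a) + Z) * (l1norm (xi a) + Z))).
    apply: (itv_measurable_switch ms
      (F := fun m t => qform (Dmx d m) (xi t))) => m.
    exact: itv_measurable_bform.
  move=> t tab; rewrite qformE (le_trans (bform_bound _ _ (Db (s t))))//.
  have h := xib _ tab.
  by rewrite ler_pM ?mulr_ge0 ?l1norm_ge0// ler_wpM2l.
- apply: itv_integrableZ.
  have [c c0 cb] := mxbounded_ex (fun m => riccati_rhs d m P).
  apply: (@itv_integrable_bounded _ _ _ _ (c * l1norm (xi a) * l1norm (xi a))).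
    apply: (itv_measurable_switch ms
      (F := fun m t => qform (riccati_rhs d m P) (xi a))) => m.
    exact: itv_measurable_cst.
  by move=> t tab; rewrite qformE bform_bound.
- apply: (@itv_integrable_le _ _ _ _
    (fun t => 2 * enorm (w t) ^+ 2 + 2 * (cf * l1norm (xi a)) ^+ 2)).
  + apply: itv_measurable_enorm_sqr => i.
    exact: feedback_deviation_measurable tr.
  + move=> t tab; rewrite ger0_norm ?sqr_ge0//.
    set f := feedback _ _ _ _.
    have : enorm f ^+ 2 <= (cf * l1norm (xi a)) ^+ 2.
      rewrite (le_trans (enorm_le_l1norm _))// lerXn2r ?nnegrE ?mulr_ge0 ?l1norm_ge0//.
      exact: fb.
    have := enorm_sqrB_le (w t) f; lra.
  + apply: itv_integrableD; first exact: itv_integrableZ.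
    exact: itv_integrable_cst.
Qed.

End OneStepEstimate.

(* [h] step length, [Y] size of the state, [Z] total variation of the
   trajectory over the step, [G] and [E] the L^1 norm and squared L^2 norm of
   the deviation from the feedback law. *)
Lemma step_variation_bound (R : realType) (h Y Z G E q K : R) :
  0 <= h -> 0 <= Y -> 0 <= Z -> 0 <= G -> 0 <= E -> 0 <= q -> 0 <= K ->
  q * h <= 2^-1 -> Z <= q * (h * (Y + Z) + G) -> G ^+ 2 <= h * (K * E) ->
  Z ^+ 2 <= 8 * q ^+ 2 * (1 + K) * (h ^+ 2 * Y ^+ 2 + h * E).
Proof.
move=> h0 Y0 Z0 G0 E0 q0 K0 qh ZG GE.
have ZZ : Z <= 2 * q * (h * Y + G).
  have : q * h * Z <= 2^-1 * Z by rewrite ler_wpM2r.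
  lra.
have Z2 : Z ^+ 2 <= (2 * q * (h * Y + G)) ^+ 2.
  by rewrite lerXn2r ?nnegrE// !mulr_ge0// addr_ge0// mulr_ge0.
have hY : (h * Y + G) ^+ 2 <= 2 * (h ^+ 2 * Y ^+ 2 + h * (K * E)).
  have := sqr_ge0 (h * Y - G); nra.
apply: (le_trans Z2); rewrite exprMn.
have -> : (2 * q) ^+ 2 = 4 * q ^+ 2 by ring.
apply: (@le_trans _ _ (4 * q ^+ 2 * (2 * (h ^+ 2 * Y ^+ 2 + h * (K * E))))).
  by rewrite ler_wpM2l// mulr_ge0 ?sqr_ge0.
rewrite -subr_ge0.
have -> : 8 * q ^+ 2 * (1 + K) * (h ^+ 2 * Y ^+ 2 + h * E)
    - 4 * q ^+ 2 * (2 * (h ^+ 2 * Y ^+ 2 + h * (K * E))) =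
  8 * q ^+ 2 * (K * (h ^+ 2 * Y ^+ 2) + h * E) by ring.
by rewrite !mulr_ge0 ?addr_ge0 ?mulr_ge0 ?sqr_ge0.
Qed.

Section OneStep.
Context {R : realType} {M n k : nat}.
Variable d : switched_data R M n k.
Local Notation state := 'cV[R]_n.
Hypothesis gam_gt0 : 0 < gam d.
Hypothesis Dmx_sym : forall m, symmetric_mx (Dmx d m).

Definition feedback_defect a b w s (xi : R -> state) P : R :=
  itv_int a b (fun t => enorm (w t - feedback d (s t) P (xi a)) ^+ 2).

Lemma feedback_defect_ge0 a b w s xi P : 0 <= feedback_defect a b w s xi P.
Proof. by apply: itv_int_ge0 => t _; exact: sqr_ge0. Qed.

(** The velocity is at most [q] times the sum of [|xi a|], the variation [Z] and the deviation from
    the feedback. Integration gives a bound for [Z] in which [Z] reappears with the factor [q h],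
    absorbed for short steps; Cauchy-Schwarz passes from the L^1 to the L^2 size of the
    deviation. *)
Lemma trajectory_variation (pb : R) : 0 <= pb ->
  exists C h0 : R, [/\ 0 < h0, 0 <= C & forall P (a b : R) w s (xi : R -> state),
    symmetric_mx P -> mxbounded P pb -> a <= b -> b - a <= h0 ->
    trajectory_on d a b w s xi ->
    itv_int a b (fun t => l1norm (velocity d w s xi t)) ^+ 2 <=
    C * ((b - a) ^+ 2 * l1norm (xi a) ^+ 2
         + (b - a) * feedback_defect a b w s xi P)].
Proof.
move=> pb0.
have [cA cA0 Ab] := mxbounded_ex (Amx d).
have [cS cS0 Sb] := mxbounded_ex (sig d).
have [cf cf0 fb] := l1norm_feedback_bound d pb0.
pose q := n%:R * (cA + cS) * (1 + cf).
have q0 : 0 <= q by rewrite !mulr_ge0 ?addr_ge0.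
(* The step bound gives [q h <= 1/2]; the factor [k%:R] is the price of comparing the l1 and
   Euclidean norms of the deviation. *)
exists (8 * q ^+ 2 * (1 + k%:R)), (2 * q + 1)^-1; split.
- by rewrite invr_gt0; lra.
- by rewrite !mulr_ge0 ?sqr_ge0// addr_ge0.
move=> P a b w s xi sP Pb ab bh tr.
have [ms mw w2 vi xiE] := tr.
have [_ _ ei] := trajectory_on_integrable pb0 Pb ab tr.
set Z := itv_int a b _; set E := feedback_defect a b w s xi P.
pose eta t := w t - feedback d (s t) P (xi a).
have zi := l1norm_velocity_integrable tr.
have meta i : itv_measurable a b (fun t => eta t i 0).
  exact: feedback_deviation_measurable tr.
have e2i : itv_integrable a b (fun t => l1norm (eta t) ^+ 2).
  apply: (@itv_integrable_le _ _ _ _ (fun t => k%:R * enorm (eta t) ^+ 2)).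
  - under eq_fun do rewrite expr2.
    by apply: itv_measurableM; exact: itv_measurable_l1norm.
  - by move=> t _; rewrite ger0_norm ?sqr_ge0// l1norm_sqr.
  - exact: itv_integrableZ.
(* On a bounded interval L^2 implies L^1, through [z <= z^2 + 1]. *)
have e1i : itv_integrable a b (fun t => l1norm (eta t)).
  apply: (@itv_integrable_le _ _ _ _ (fun t => l1norm (eta t) ^+ 2 + cst 1 t)).
  - exact: itv_measurable_l1norm.
  - move=> t _ /=; rewrite ger0_norm ?l1norm_ge0//.
    have := sqr_ge0 (l1norm (eta t) - 1); have := l1norm_ge0 (eta t); nra.
  - by apply: itv_integrableD => //; exact: itv_integrable_cst.
set G := itv_int a b (fun t => l1norm (eta t)).
have Z0 : 0 <= Z by apply: itv_int_ge0 => t _; exact: l1norm_ge0.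
apply: (@step_variation_bound _ _ _ _ G) => //.
- by rewrite subr_ge0.
- exact: l1norm_ge0.
- by apply: itv_int_ge0 => t _; exact: l1norm_ge0.
- exact: feedback_defect_ge0.
- apply: (@le_trans _ _ (q * (2 * q + 1)^-1)); first by rewrite ler_wpM2l.
  by rewrite ler_pdivrMr; lra.
- have -> : (b - a) * (l1norm (xi a) + Z) + G =
      itv_int a b (fun t => cst (l1norm (xi a) + Z) t + l1norm (eta t)).
    rewrite itv_intD//; last exact: itv_integrable_cst.
    by rewrite itv_int_cst// mulrC.
  have ti : itv_integrable a b (fun t => cst (l1norm (xi a) + Z) t + l1norm (eta t)).
    by apply: itv_integrableD => //; exact: itv_integrable_cst.
  rewrite -itv_intZ//; apply: le_itv_int => //; first exact: itv_integrableZ.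
  move=> t tab /=.
  have := trajectory_on_displacement tr tab; rewrite -/Z => dis.
  have xit : l1norm (xi t) <= l1norm (xi a) + Z.
    have := l1normD (xi a) (xi t - xi a); rewrite addrC subrK; lra.
  have wt : l1norm (w t) <= l1norm (eta t) + cf * l1norm (xi a).
    have := l1normD (eta t) (feedback d (s t) P (xi a)); rewrite subrK.
    have := fb (s t) P (xi a) Pb; lra.
  rewrite (le_trans (l1normD _ _))// /q.
  have h1 := l1norm_mulmx (xi t) (Ab (s t)).
  have h2 := l1norm_mulmx (w t) (Sb (s t)).
  rewrite (le_trans (lerD h1 h2))// -!mulrA -mulrDr ler_wpM2l//.
  set Y := l1norm (xi a) in dis xit wt *; set e := l1norm (eta t) in wt *.
  have Y0 : 0 <= Y by exact: l1norm_ge0.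
  have e0 : 0 <= e by exact: l1norm_ge0.
  have h3 : cA * l1norm (xi t) <= cA * (Y + Z) by rewrite ler_wpM2l.
  have h4 : cS * l1norm (w t) <= cS * (e + cf * Y) by rewrite ler_wpM2l.
  rewrite (le_trans (lerD h3 h4))// mulrDl lerD// ler_wpM2l//.
    have := mulr_ge0 cf0 (addr_ge0 (addr_ge0 Y0 Z0) e0); lra.
  have := mulr_ge0 cf0 (addr_ge0 Z0 e0); lra.
- rewrite (le_trans (itv_int_sqr_le ab e1i e2i))// ler_wpM2l ?subr_ge0//.
  rewrite -itv_intZ//; apply: le_itv_int => //; first exact: itv_integrableZ.
  by move=> t _; exact: l1norm_sqr.
Qed.

(** The estimate is two-sided: the upper half bounds arbitrary disturbances, the lower half shows
    that the feedback is optimal. The error contains the defect with the factor [b - a], so for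
    short steps the term with [gam d ^+ 2 / 2] dominates it. *)
Lemma one_step_estimate (pb : R) : 0 <= pb ->
  exists C h0 : R, [/\ 0 < h0, 0 <= C & forall P (a b : R) w s (xi : R -> state),
    symmetric_mx P -> mxbounded P pb -> a <= b -> b - a <= h0 ->
    trajectory_on d a b w s xi ->
    `|itv_int a b (running_cost d w s xi) + 2^-1 * qform P (xi b)
      - 2^-1 * qform P (xi a)
      - itv_int a b (fun t => 2^-1 * qform (riccati_rhs d (s t) P) (xi a))
      + gam d ^+ 2 / 2 * feedback_defect a b w s xi P| <=
    C * ((b - a) ^+ 2 * l1norm (xi a) ^+ 2
         + (b - a) * feedback_defect a b w s xi P)].
Proof.
move=> pb0.
have [Q [h0 [h00 Q0 Zb]]] := trajectory_variation pb0.
have [cA cA0 Ab] := mxbounded_ex (Amx d).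
have [cD cD0 Db] := mxbounded_ex (Dmx d).
pose c2 := cD + n%:R * (pb * cA).
have c20 : 0 <= c2 by rewrite addr_ge0// !mulr_ge0.
exists (c2 * (1 + Q) + cD * Q + pb * Q), (Num.min h0 1); split.
- by rewrite lt_min h00 ltr01.
- by rewrite !addr_ge0// !mulr_ge0// addr_ge0.
move=> P a b w s xi sP Pb ab; rewrite le_min => /andP[bh0 bh1] tr.
have [ms mw w2 vi xiE] := tr.
have [ri pi ei] := trajectory_on_integrable pb0 Pb ab tr.
have := Zb P a b w s xi sP Pb ab bh0 tr.
set Z := itv_int a b _; set E := feedback_defect a b w s xi P.
have E0 : 0 <= E by exact: feedback_defect_ge0.
have Z0 : 0 <= Z by apply: itv_int_ge0 => t _; exact: l1norm_ge0.
set Y := l1norm (xi a); have Y0 : 0 <= Y by exact: l1norm_ge0.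
set h := b - a; have hge0 : 0 <= h by rewrite subr_ge0.
set W := h ^+ 2 * Y ^+ 2 + h * E => ZW.
have W0 : 0 <= W by rewrite addr_ge0// !mulr_ge0 ?sqr_ge0.
pose De t := xi t - xi a.
have Deb t : a <= t <= b -> l1norm (De t) <= Z.
  by move=> tab; exact: (trajectory_on_displacement tr tab).
have vE i : De b i 0 = itv_int a b (fun t => velocity d w s xi t i 0).
  by rewrite !mxE xiE ?ab ?lexx// addrAC subrr add0r.
have [bi bE] := itv_int_bform (xi a) P vi vE.
have xiD t : xi a + De t = xi t by rewrite addrC subrK.
(* [Rm] collects the displacement terms of the completed square; it is bounded pointwise by the
   variation [Z]. *)
pose Rm t := bform (xi a) (Dmx d (s t) + P *m Amx d (s t)) (De t)
  + 2^-1 * qform (Dmx d (s t)) (De t).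
have RmE t : Rm t = running_cost d w s xi t + bform (xi a) P (velocity d w s xi t)
    - 2^-1 * qform (riccati_rhs d (s t) P) (xi a)
    + gam d ^+ 2 / 2 * enorm (w t - feedback d (s t) P (xi a)) ^+ 2.
  have := running_cost_completion (xi a) (De t) (w t) gam_gt0 (Dmx_sym (s t)) sP.
  rewrite xiD -/(velocity d w s xi t) -/(running_cost d w s xi t) => ->.
  by rewrite /Rm; ring.
have i1 := itv_integrableD ri bi.
have i2 := itv_integrableB i1 pi.
have i3 := itv_integrableZ (gam d ^+ 2 / 2) ei.
have Rmi : itv_integrable a b Rm.
  by apply: eq_itv_integrable (itv_integrableD i2 i3) => t _; rewrite -RmE.
have Rmb t : a <= t <= b -> `|Rm t| <= c2 * Y * Z + cD * Z ^+ 2.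
  move=> tab; have := Deb t tab; set z := l1norm (De t) => zZ.
  have z0 : 0 <= z by exact: l1norm_ge0.
  have b1 : mxbounded (Dmx d (s t) + P *m Amx d (s t)) c2.
    exact/mxboundedD/mxboundedM.
  rewrite (le_trans (ler_normD _ _))// lerD//.
    by rewrite (le_trans (bform_bound _ _ b1))// ler_wpM2l// mulr_ge0.
  rewrite qformE normrM ger0_norm//.
  have h1 := bform_bound (De t) (De t) (Db (s t)); rewrite -/z in h1.
  have h2 : cD * z * z <= cD * Z ^+ 2.
    by rewrite -mulrA ler_wpM2l// expr2 ler_pM.
  have := normr_ge0 (bform (De t) (Dmx d (s t)) (De t)); lra.
have IRm := itv_int_norm_bound ab Rmi Rmb.
have IE : itv_int a b Rm = itv_int a b (running_cost d w s xi)
    + bform (xi a) P (De b)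
    - itv_int a b (fun t => 2^-1 * qform (riccati_rhs d (s t) P) (xi a))
    + gam d ^+ 2 / 2 * E.
  rewrite bE /E /feedback_defect -itv_intZ// -itv_intD// -itv_intB// -itv_intD//.
  exact: eq_itv_int.
have qb : qform P (xi b) = qform P (xi a) + 2 * bform (xi a) P (De b) + qform P (De b).
  rewrite -[in LHS](xiD b) !qformE; move: (De b) => v.
  by rewrite !bformDl !bformDr (bformC v) sP; ring.
have qDe : `|qform P (De b)| <= pb * Z ^+ 2.
  rewrite qformE (le_trans (bform_bound _ _ Pb))// -mulrA ler_wpM2l//.
  by rewrite expr2 ler_pM ?l1norm_ge0// Deb// ab lexx.
(* Freezing the left factor of the [P] term costs exactly the quadratic form of the total
   displacement, which is of order [Z^2]. *)
rewrite [X in `|X|](_ : _ = itv_int a b Rm + 2^-1 * qform P (De b)); last first.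
  by rewrite IE qb -/E; field.
rewrite (le_trans (ler_normD _ _))// [X in _ + X]normrM [`|2^-1|]ger0_norm//.
apply: (@le_trans _ _ (c2 * (h * (Y * Z)) + cD * Z ^+ 2 + pb * Z ^+ 2)).
  apply: lerD; last first.
    by have := normr_ge0 (qform P (De b)); lra.
  rewrite (le_trans IRm)// mulrDl lerD//; first by rewrite /h; lra.
  by rewrite -mulrA ler_wpM2l// ler_piMr// sqr_ge0.
(* The product [h Y Z] is split as [(h Y)^2 + Z^2], both controlled by [W]. *)
have hYZ : h * (Y * Z) <= (1 + Q) * W.
  have : h ^+ 2 * Y ^+ 2 <= W by rewrite lerDl mulr_ge0.
  have := sqr_ge0 (h * Y - Z); have := mulr_ge0 Q0 W0; lra.
have k1 : c2 * (h * (Y * Z)) <= c2 * ((1 + Q) * W) by rewrite ler_wpM2l.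
have k2 : cD * Z ^+ 2 <= cD * (Q * W) by rewrite ler_wpM2l.
have k3 : pb * Z ^+ 2 <= pb * (Q * W) by rewrite ler_wpM2l.
lra.
Qed.

End OneStep.

(** * Riccati flows for short times *)

Section HalfLine.
Context {R : realType}.
Implicit Types (f df : R -> R) (s t b : R).

Lemma within_continuous_right f df b : 0 <= b ->
  (forall t, 0 < t <= b -> is_derive t 1 f (df t)) ->
  f @ 0^'+ --> f 0 -> {within `[0, b], continuous f}.
Proof.
rewrite le_eqVlt => /predU1P[<- _ _|b0 fd f0].
  by rewrite set_itv1; exact: continuous_subspace1.
have fc t : 0 < t <= b -> {for t, continuous f}.
  move=> /fd [d _]; apply/differentiable_continuous.
  exact/derivable1_diffP.
apply/continuous_within_itvP => //; split => //.
- by move=> t; rewrite in_itv/= => /andP[t0 /ltW tb]; apply: fc; rewrite t0.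
- by apply: cvg_at_left_filter; apply: fc; rewrite b0 lexx.
Qed.

(** A Riccati solution is differentiable only after time 0 and has a right limit there; this still
    gives the continuity on the closed interval that the mean value theorem requires. *)
Lemma mvt_right f df b s t : 0 <= b ->
  (forall u, 0 < u <= b -> is_derive u 1 f (df u)) ->
  f @ 0^'+ --> f 0 -> 0 <= s <= t -> t <= b ->
  exists2 c, s <= c <= t & f t - f s = df c * (t - s).
Proof.
move=> b0 fd f0 /andP[s0 st] tb.
have [||c] := @MVT_segment R f df s t st.
- move=> u; rewrite in_itv/= => /andP[su ut]; apply: fd.
  by rewrite (le_lt_trans s0 su) (le_trans (ltW ut) tb).
- apply: continuous_subspaceW (within_continuous_right b0 fd f0).
  exact: sub_itv.
by rewrite in_itv/=; exists c.
Qed.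

(* [1 / (1 + g)] has slope at least [- C]. *)
Lemma quadratic_growth_le1 (g dg : R -> R) b t C : 0 <= t <= b ->
  (forall u, 0 < u <= b -> is_derive u 1 g (dg u)) ->
  g @ 0^'+ --> g 0 -> g 0 = 0 -> (forall u, 0 <= g u) ->
  (forall u, 0 <= u <= b -> `|dg u| <= C * (1 + g u) ^+ 2) ->
  C * t <= 2^-1 -> g t <= 1.
Proof.
move=> /andP[t0 tb] gd gc g0 gge0 gC Ct.
have gp u : 1 + g u != 0 by rewrite gt_eqF// ltr_wpDr.
have hd u : 0 < u <= b ->
    is_derive u 1 (fun v => (1 + g v)^-1) (- (1 + g u) ^- 2 * dg u).
  move=> /gd gdu; apply: is_deriveV => //.
  have : is_derive (u : R) (1 : R) (cst (1 : R) + g) (0 + dg u).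
    by apply: is_deriveD.
  by rewrite add0r.
have hc : (fun v => (1 + g v)^-1) @ 0^'+ --> (1 + g 0)^-1.
  apply: cvgV => //; apply: cvgD => //; exact: cvg_cst.
have [|c /andP[c0 ct] e] := mvt_right (le_trans t0 tb) hd hc _ tb (s := 0).
  by rewrite lexx t0.
have := gC c; rewrite c0 (le_trans ct tb) => /(_ isT).
rewrite ler_norml => /andP[_ dgc].
rewrite g0 subr0 addr0 invr1 in e.
have gt0 : 0 < 1 + g t by rewrite ltr_wpDr.
have gc0 : 0 < (1 + g c) ^+ 2 by rewrite exprn_gt0// ltr_wpDr.
have : (1 + g c) ^- 2 * dg c <= C by rewrite mulrC ler_pdivrMr.
move=> /(ler_wpM2r t0) h.
have : 2^-1 <= (1 + g t)^-1 by lra.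
by rewrite lef_pV2 ?posrE//; lra.
Qed.

End HalfLine.

(** * Growth and Lipschitz bounds for the Riccati right-hand side *)

Section RiccatiEstimates.
Context {R : realType} {M n k : nat}.
Variable d : switched_data R M n k.

Lemma riccati_rhs_bound :
  exists2 K : R, 0 <= K & forall m P p, 0 <= p -> mxbounded P p ->
    mxbounded (riccati_rhs d m P) (K * (1 + p) ^+ 2).
Proof.
have [cA cA0 Ab] := mxbounded_ex (Amx d).
have [cD cD0 Db] := mxbounded_ex (Dmx d).
have [cS cS0 Sb] := mxbounded_ex (Sigma_mx d).
exists (n%:R * cA + n%:R * (n%:R * cS) + cD); first by rewrite !addr_ge0// !mulr_ge0.
move=> m P p p0 Pb.
have h1 := mxboundedM (mxbounded_tr (Ab m)) Pb.
have h2 := mxboundedM Pb (Ab m).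
have h3 := mxboundedM (mxboundedM Pb (Sb m)) Pb.
apply: mxbounded_le (mxboundedD (mxboundedD (mxboundedD h1 h2) h3) (Db m)) _.
have nA : 0 <= n%:R * cA by rewrite mulr_ge0.
have nS : 0 <= n%:R * (n%:R * cS) by rewrite !mulr_ge0.
have := mulr_ge0 nA (sqr_ge0 p); have := mulr_ge0 nS p0; have := mulr_ge0 cD0 p0.
have := mulr_ge0 cD0 (sqr_ge0 p).
nra.
Qed.

Lemma riccati_rhs_lipschitz :
  exists2 K : R, 0 <= K & forall m P P' p e, 0 <= p -> 0 <= e ->
    mxbounded P p -> mxbounded P' p -> mxbounded (P' - P) e ->
    mxbounded (riccati_rhs d m P' - riccati_rhs d m P) (K * (1 + p) * e).
Proof.
have [cA cA0 Ab] := mxbounded_ex (Amx d).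
have [cS cS0 Sb] := mxbounded_ex (Sigma_mx d).
exists (2 * n%:R * cA + 2 * n%:R * (n%:R * cS)).
  by rewrite !addr_ge0// !mulr_ge0.
move=> m P P' p e p0 e0 Pb P'b Eb.
(* The quadratic term is telescoped, replacing one factor [P] at a time. *)
have -> : riccati_rhs d m P' - riccati_rhs d m P =
   (Amx d m)^T *m (P' - P) + (P' - P) *m Amx d m
   + (P' - P) *m Sigma_mx d m *m P' + P *m Sigma_mx d m *m (P' - P).
  rewrite /riccati_rhs !mulmxBr !mulmxBl.
  set a := _ *m P'; set b := _ *m P; set c := P' *m _; set e1 := P *m _.
  set f := _ *m P'; set g := _ *m P; set h := _ *m P'.
  set D := Dmx d m.
  by apply/matrixP => i j; rewrite !mxE; ring.
have h1 := mxboundedM (mxbounded_tr (Ab m)) Eb.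
have h2 := mxboundedM Eb (Ab m).
have h3 := mxboundedM (mxboundedM Eb (Sb m)) P'b.
have h4 := mxboundedM (mxboundedM Pb (Sb m)) Eb.
apply: mxbounded_le (mxboundedD (mxboundedD (mxboundedD h1 h2) h3) h4) _.
rewrite -subr_ge0.
have -> : (2 * n%:R * cA + 2 * n%:R * (n%:R * cS)) * (1 + p) * e -
  (n%:R * (cA * e) + n%:R * (e * cA) + n%:R * (n%:R * (e * cS) * p) +
   n%:R * (n%:R * (p * cS) * e)) =
  2 * (n%:R * (cA * (p * e))) + 2 * (n%:R * (n%:R * (cS * e))) by ring.
by rewrite addr_ge0// !mulr_ge0.
Qed.

End RiccatiEstimates.

(** * A priori bound and Taylor expansion of Riccati solutions *)

Section RiccatiShortTime.
Context {R : realType} {M n k : nat}.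
Variable d : switched_data R M n k.

Lemma riccati_solution_entry m (P0 : 'M[R]_n) T P b i j :
  riccati_solution d m P0 T P -> (b%:E < T)%E ->
  (forall t, 0 < t <= b ->
    is_derive t 1 (fun u => P u i j) (riccati_rhs d m (P t) i j)) /\
  (fun u => P u i j) @ 0^'+ --> P 0 i j.
Proof.
move=> [-> _ P0c Pd] bT; split=> // t /andP[t0 tb].
by apply: Pd => //; apply: le_lt_trans bT; rewrite lee_fin.
Qed.

(** The sum [g] of the squared entries of [P - P0] is differentiable and satisfies
    [|g'| <= C (1 + g)^2], so it stays below 1 for a time depending only on [pb] and the data. This
    rules out blow-up uniformly in the mode and the initial matrix. *)
Lemma riccati_solution_bound (pb : R) : 0 <= pb ->
  exists2 t0 : R, 0 < t0 & forall m P0 T P t, riccati_solution d m P0 T P ->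
    mxbounded P0 pb -> 0 <= t <= t0 -> (t%:E < T)%E ->
    mxbounded (P t) (pb + 1).
Proof.
move=> pb0; have [K K0 Kb] := riccati_rhs_bound d.
(* There are [n^2] entries, each square contributes a factor 2 when differentiated, and
   [e (1 + e)^2 <= 2 (1 + e^2)^2] gives the other 2. *)
pose C := 4 * n%:R ^+ 2 * (K * (1 + pb) ^+ 2).
have C0 : 0 <= C by rewrite /C !mulr_ge0// ?exprn_ge0//; lra.
exists (2 * C + 1)^-1; first by rewrite invr_gt0; lra.
move=> m P0 T P t sol P0b /andP[t0 tt0] tT.
pose h i j := (fun u => (P u i j - P0 i j) ^+ 2).
pose g := (fun u : R => \sum_i \sum_j h i j u).
pose dg u := \sum_i \sum_j 2 * (P u i j - P0 i j) * riccati_rhs d m (P u) i j.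
have hg i j u : h i j u <= g u.
  rewrite /g (bigD1 i)//= (bigD1 j)//= -addrA lerDl addr_ge0//.
    by rewrite sumr_ge0// => l _; exact: sqr_ge0.
  by rewrite sumr_ge0// => l _; rewrite sumr_ge0// => l' _; exact: sqr_ge0.
have gge0 u : 0 <= g u.
  by rewrite /g sumr_ge0// => l _; rewrite sumr_ge0// => l' _; exact: sqr_ge0.
have P0E : P 0 = P0 by case: sol.
suff g1 : g t <= 1.
  move=> i j; have := le_trans (hg i j t) g1; rewrite /h => hh.
  have : `|P t i j - P0 i j| <= 1.
    by rewrite -(@expr_le1 _ 2)// real_normK// num_real.
  have := ler_normD (P t i j - P0 i j) (P0 i j); rewrite subrK.
  have := P0b i j; lra.
apply: (@quadratic_growth_le1 _ g dg t t C).
- by rewrite t0 lexx.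
- move=> u ut.
  have -> : g = \sum_(i < n) \sum_(j < n) h i j.
    by apply/funext => v; rewrite fct_sumE; apply: eq_bigr => i _; rewrite fct_sumE.
  apply: is_derive_sum => i; apply: is_derive_sum => j.
  have [/(_ u ut) Pd _] := riccati_solution_entry i j sol tT.
  have /(is_deriveX 2) e : is_derive (u : R) (1 : R) ((fun v => P v i j) - cst (P0 i j))
     (riccati_rhs d m (P u) i j - 0) by apply: is_deriveB.
  by apply: is_derive_eq e _; rewrite subr0 /GRing.scale/= expr1.
- apply: cvg_big => [|i _]; first exact: add_continuous.
  apply: cvg_big => [|j _]; first exact: add_continuous.
  have [_ Pc] := riccati_solution_entry i j sol tT.
  by apply: cvgM; apply: cvgB => //; exact: cvg_cst.
- rewrite /g big1// => i _; rewrite big1// => j _.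
  by rewrite /h P0E subrr expr0n.
- exact: gge0.
- move=> u ut; set e := Num.sqrt (g u).
  have e0 : 0 <= e by exact: sqrtr_ge0.
  have e2 : e ^+ 2 = g u by rewrite sqr_sqrtr.
  have Eb i j : `|P u i j - P0 i j| <= e.
    by rewrite -sqrtr_sqr; exact: ler_wsqrtr (hg i j u).
  have Pb : mxbounded (P u) (pb + e).
    move=> i j; have := ler_normD (P u i j - P0 i j) (P0 i j); rewrite subrK.
    have := P0b i j; have := Eb i j; lra.
  have Fb := Kb m _ _ (addr_ge0 pb0 e0) Pb.
  have h1 : `|dg u| <= n%:R * (n%:R * (2 * e * (K * (1 + (pb + e)) ^+ 2))).
    apply: normr_sum_ord_le => i; apply: normr_sum_ord_le => j.
    rewrite !normrM ler_pM// ?mulr_ge0// ger0_norm//.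
    by rewrite ler_wpM2l.
  rewrite (le_trans h1)// -e2 /C -subr_ge0.
  have -> : 4 * n%:R ^+ 2 * (K * (1 + pb) ^+ 2) * (1 + e ^+ 2) ^+ 2
     - n%:R * (n%:R * (2 * e * (K * (1 + (pb + e)) ^+ 2))) =
     2 * n%:R ^+ 2 * K * (2 * (1 + pb) ^+ 2 * (1 + e ^+ 2) ^+ 2
       - e * (1 + (pb + e)) ^+ 2) by ring.
  rewrite !mulr_ge0 ?sqr_ge0// subr_ge0.
  apply: (@le_trans _ _ (e * ((1 + pb) * (1 + e)) ^+ 2)).
    rewrite ler_wpM2l// lerXn2r ?nnegrE ?mulr_ge0 ?addr_ge0//.
    have := mulr_ge0 pb0 e0; lra.
  have he : (1 + e) ^+ 2 <= 2 * (1 + e ^+ 2) by have := sqr_ge0 (1 - e); lra.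
  have he' : e <= 1 + e ^+ 2 by have := sqr_ge0 (1 - e); have := sqr_ge0 e; lra.
  have q0 : 0 <= 2 * (1 + e ^+ 2) by rewrite mulr_ge0// addr_ge0// sqr_ge0.
  have h2 := le_trans (ler_wpM2l e0 he) (ler_wpM2r q0 he').
  have := ler_wpM2l (sqr_ge0 (1 + pb)) h2; lra.
- apply: (@le_trans _ _ (C * (2 * C + 1)^-1)); first by rewrite ler_wpM2l.
  by rewrite ler_pdivrMr; lra.
Qed.

(** The mean value theorem is applied entry by entry, with an intermediate time that depends on the
    entry. Boundedness gives the first-order bound; the Lipschitz bound on the right-hand side then
    gives the second-order one. *)
Lemma riccati_solution_taylor (pb : R) : 0 <= pb ->
  exists C t0 : R, [/\ 0 <= C, 0 < t0 & forall m P0 T P s t,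
    riccati_solution d m P0 T P -> mxbounded P0 pb ->
    0 <= s <= t -> t <= t0 -> (t%:E < T)%E ->
    [/\ mxbounded (P s) (pb + 1), mxbounded (P t - P s) (C * (t - s)) &
      mxbounded (P t - P s - (t - s) *: riccati_rhs d m (P s))
        (C * (t - s) ^+ 2)]].
Proof.
move=> pb0; have [t0 t00 Pbd] := riccati_solution_bound pb0.
have [K K0 Kb] := riccati_rhs_bound d.
have [L L0 Lb] := riccati_rhs_lipschitz d.
have pb1 : 0 <= pb + 1 by lra.
pose C1 := K * (1 + (pb + 1)) ^+ 2.
have C10 : 0 <= C1 by rewrite mulr_ge0// sqr_ge0.
pose C2 := L * (1 + (pb + 1)) * C1.
have C20 : 0 <= C2 by rewrite !mulr_ge0//; lra.
exists (C1 + C2), t0; split => //; first exact: addr_ge0.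
move=> m P0 T P s t sol P0b /andP[s0 st] tt0 tT.
have Pu u : 0 <= u <= t -> mxbounded (P u) (pb + 1).
  move=> /andP[u0 ut]; apply: Pbd sol P0b _ _; first by rewrite u0 (le_trans ut).
  by apply: le_lt_trans tT; rewrite lee_fin.
have lip u v i j : 0 <= u <= v -> v <= t ->
    exists2 c, u <= c <= v & P v i j - P u i j = riccati_rhs d m (P c) i j * (v - u).
  move=> uv vt; have [Pd Pc] := riccati_solution_entry i j sol tT.
  exact: (mvt_right (le_trans s0 st) Pd Pc uv vt).
have lipb u v : 0 <= u <= v -> v <= t -> mxbounded (P v - P u) (C1 * (v - u)).
  move=> /[dup] uv /andP[u0 u_v] vt i j.
  have [c /andP[uc cv] e] := lip u v i j uv vt.
  rewrite !mxE e normrM [`|v - u|]ger0_norm ?subr_ge0// ler_wpM2r ?subr_ge0//.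
  by apply: Kb => //; apply: Pu; rewrite (le_trans u0 uc) (le_trans cv vt).
have ts : 0 <= t - s by rewrite subr_ge0.
split.
- by apply: Pu; rewrite s0 st.
- apply: mxbounded_le (lipb s t _ _) _; rewrite ?s0 ?st//.
  by rewrite ler_wpM2r// lerDl.
- move=> i j; have [|//|c /andP[sc ct] e] := lip s t i j; first by rewrite s0 st.
  have -> : (P t - P s - (t - s) *: riccati_rhs d m (P s)) i j =
     (riccati_rhs d m (P c) - riccati_rhs d m (P s)) i j * (t - s).
    move: (riccati_rhs d m (P c)) (riccati_rhs d m (P s)) e => Fc Fs e.
    by rewrite !mxE e; ring.
  rewrite normrM [`|t - s|]ger0_norm// expr2 mulrA ler_wpM2r//.
  apply: (@le_trans _ _ (L * (1 + (pb + 1)) * (C1 * (t - s)))).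
    apply: Lb => //.
    - by rewrite mulr_ge0.
    - by apply: Pu; rewrite s0 st.
    - by apply: Pu; rewrite (le_trans s0 sc) ct.
    - apply: mxbounded_le (lipb s c _ ct) _; first by rewrite s0 sc.
      by rewrite ler_wpM2l// lerD2r.
  by rewrite mulrA -/C2 ler_wpM2r// lerDr.
Qed.

End RiccatiShortTime.

(** * Linear differential equations *)

Section LinearODE.
Context {R : realType}.

Lemma dyadic_small (C e : R) : 0 <= C -> 0 < e -> exists k : nat, C / 2 ^+ k <= e.
Proof.
move=> C0 e0; have Ce : 0 <= C / e by rewrite divr_ge0// ltW.
exists (Num.bound (C / e)).
rewrite ler_pdivrMr ?exprn_gt0// mulrC -ler_pdivrMr//.
have /ltW h := archi_boundP Ce; apply: (le_trans h).
by rewrite -natrX ler_nat ltnW// ltn_expl.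
Qed.

Lemma dyadic_antimono (C : R) k l : 0 <= C -> (k <= l)%N -> C / 2 ^+ l <= C / 2 ^+ k.
Proof.
move=> C0 kl; rewrite ler_wpM2l// lef_pV2 ?posrE ?exprn_gt0//.
by rewrite ler_weXn2l// ler1n.
Qed.

Lemma le0_dyadic (x C : R) : 0 <= C -> (forall k, x <= C / 2 ^+ k) -> x <= 0.
Proof.
move=> C0 xC; rewrite leNgt; apply/negP => x0.
have [k] := dyadic_small C0 (divr_gt0 x0 (ltr0Sn R 1)); have := xC k; lra.
Qed.

(* The limit is squeezed between the nondecreasing sequence [X k - 2 c / 2 ^ k]
   and the nonincreasing sequence [X k + 2 c / 2 ^ k]. *)
Lemma dyadic_cauchy (X : nat -> R) c : 0 <= c ->
  (forall k, `|X k.+1 - X k| <= c / 2 ^+ k) ->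
  exists l, forall k, `|l - X k| <= 2 * c / 2 ^+ k.
Proof.
move=> c0 Xc; pose a k := X k - 2 * c / 2 ^+ k; pose b k := X k + 2 * c / 2 ^+ k.
have half k : c / 2 ^+ k.+1 = c / 2 ^+ k / 2.
  by rewrite exprSr invfM mulrA.
have dE k : 2 * c / 2 ^+ k = 2 * (c / 2 ^+ k) by rewrite mulrA.
have aS k : a k <= a k.+1.
  by rewrite /a !dE half; have := Xc k; rewrite ler_norml => /andP[]; lra.
have bS k : b k.+1 <= b k.
  by rewrite /b !dE half; have := Xc k; rewrite ler_norml => /andP[]; lra.
have /nondecreasing_seqP am : forall k, a k <= a k.+1 by [].
have /nonincreasing_seqP bm : forall k, b k.+1 <= b k by [].
have ab k l : a k <= b l.
  apply: (@le_trans _ _ (a (maxn k l))); first by apply: am; exact: leq_maxl.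
  apply: (@le_trans _ _ (b (maxn k l))); last by apply: bm; exact: leq_maxr.
  rewrite /a /b; set z := _ / _.
  have : 0 <= z by rewrite /z divr_ge0// ?mulr_ge0// exprn_ge0.
  lra.
exists (sup (range a)) => k.
have h1 : a k <= sup (range a).
  apply: ub_le_sup; last by exists k.
  by exists (b 0%N) => _ [j _ <-].
have h2 : sup (range a) <= b k.
  apply: ge_sup; first by exists (a 0%N), 0%N.
  by move=> _ [j _ <-].
by rewrite ler_norml; move: h1 h2; rewrite /a /b; lra.
Qed.

(** The coefficients are only measurable, so the equation is kept in integral form. The smallness
    condition makes the Picard map contract by 1/2 in the uniform norm, so consecutive iterates
    differ by at most [l1norm x / 2 ^+ k]. *)
Lemma linear_ode n (B : R -> 'M[R]_n) (x : 'cV[R]_n) (tau beta : R) :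
  0 <= tau -> 0 <= beta ->
  (forall i j, itv_measurable 0 tau (fun t => B t i j)) ->
  (forall t, 0 <= t <= tau -> mxbounded (B t) beta) ->
  n%:R * beta * tau <= 2^-1 ->
  exists xi : R -> 'cV[R]_n,
    [/\ forall i, itv_measurable 0 tau (fun t => xi t i 0),
        forall t, 0 <= t <= tau -> l1norm (xi t) <= n%:R * (3 * l1norm x),
        forall i, itv_integrable 0 tau (fun t => (B t *m xi t) i 0) &
        forall t i, 0 <= t <= tau ->
          xi t i 0 = x i 0 + itv_int 0 t (fun u => (B u *m xi u) i 0)].
Proof.
move=> tau0 beta0 mB Bb small.
pose step (X : R -> 'cV[R]_n) t : 'cV[R]_n :=
  \col_i (x i 0 + itv_int 0 t (fun u => (B u *m X u) i 0)).
pose X k := iter k step (fun=> x).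
have mBX (Y : R -> 'cV[R]_n) : (forall i, itv_measurable 0 tau (fun t => Y t i 0)) ->
    forall i, itv_measurable 0 tau (fun t => (B t *m Y t) i 0).
  move=> mY i; under eq_fun do rewrite mxE.
  by apply: itv_measurable_sum => j; exact: itv_measurableM.
have BYb (Y : 'cV[R]_n) t e i : 0 <= t <= tau -> (forall j, `|Y j 0| <= e) ->
    `|(B t *m Y) i 0| <= n%:R * (beta * e).
  move=> tt Ye; rewrite mxE; apply: normr_sum_ord_le => j.
  by rewrite normrM ler_pM//; exact: Bb.
have iBY (Y : R -> 'cV[R]_n) e : (forall i, itv_measurable 0 tau (fun t => Y t i 0)) ->
    (forall t i, 0 <= t <= tau -> `|Y t i 0| <= e) ->
    forall i, itv_integrable 0 tau (fun t => (B t *m Y t) i 0).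
  move=> mY Ye i; apply: (@itv_integrable_bounded _ _ _ _ (n%:R * (beta * e))).
    exact: mBX.
  by move=> t tt; apply: BYb => // j; exact: Ye.
have contr (Y Z : R -> 'cV[R]_n) e t i :
    (forall i, itv_integrable 0 tau (fun t => (B t *m Y t) i 0)) ->
    (forall i, itv_integrable 0 tau (fun t => (B t *m Z t) i 0)) ->
    0 <= t <= tau -> (forall u j, 0 <= u <= tau -> `|Y u j 0 - Z u j 0| <= e) ->
    `|itv_int 0 t (fun u => (B u *m Y u) i 0)
      - itv_int 0 t (fun u => (B u *m Z u) i 0)| <= e / 2.
  move=> iY iZ /andP[t0 tt] YZ.
  have iYt : itv_integrable 0 t (fun t => (B t *m Y t) i 0).
    exact: itv_integrableS (iY i).
  have iZt : itv_integrable 0 t (fun t => (B t *m Z t) i 0).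
    exact: itv_integrableS (iZ i).
  have e0 : 0 <= e.
    by apply: le_trans (YZ 0 i _); rewrite ?lexx ?tau0.
  rewrite -itv_intB//.
  have := @itv_int_norm_bound _ 0 t _ (n%:R * (beta * e)) t0 (itv_integrableB iYt iZt) _.
  move=> /(_ _)/le_trans; apply.
    move=> u /andP[u0 ut].
    have utau : 0 <= u <= tau by rewrite u0 (le_trans ut).
    have -> : (B u *m Y u) i 0 - (B u *m Z u) i 0 = (B u *m (Y u - Z u)) i 0.
      by rewrite mulmxBr !mxE.
    by apply: BYb => // j; rewrite !mxE; exact: YZ.
  rewrite subr0; apply: (@le_trans _ _ (n%:R * beta * tau * e)).
    have nbe : 0 <= n%:R * beta * e by rewrite !mulr_ge0.
    have := ler_wpM2l nbe tt; lra.
  by rewrite mulrC ler_wpM2l.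
pose c := l1norm x.
have c0 : 0 <= c by exact: l1norm_ge0.
have Xinv k : (forall i, itv_measurable 0 tau (fun t => X k t i 0)) /\
    exists e, forall t i, 0 <= t <= tau -> `|X k t i 0| <= e.
  elim: k => [|k [mX [e Xe]]].
    split; first by move=> i; exact: itv_measurable_cst.
    by exists c => t i _; exact: le_l1norm.
  have iX := iBY _ _ mX Xe.
  split.
    move=> i; under eq_fun do rewrite /= mxE.
    apply: itv_measurableD; first exact: itv_measurable_cst.
    exact: itv_measurable_int.
  exists (c + n%:R * (beta * e) * tau) => t i /andP[t0 tt] /=.
  rewrite mxE (le_trans (ler_normD _ _))// lerD ?le_l1norm//.
  apply: (@le_trans _ _ (n%:R * (beta * e) * (t - 0))).
    apply: itv_int_norm_bound => //.
      exact: itv_integrableS (iX i).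
    move=> u /andP[u0 ut]; apply: BYb; first by rewrite u0 (le_trans ut).
    by move=> j; apply: Xe; rewrite u0 (le_trans ut).
  rewrite subr0 ler_wpM2l// !mulr_ge0//.
  by apply: le_trans (Xe 0 i _); rewrite ?lexx ?tau0.
have iX k i : itv_integrable 0 tau (fun t => (B t *m X k t) i 0).
  by have [mX [e Xe]] := Xinv k; exact: iBY Xe i.
have Xd k t i : 0 <= t <= tau -> `|X k.+1 t i 0 - X k t i 0| <= c / 2 ^+ k.
  elim: k t i => [|k ih] t i tt.
    rewrite /X /= mxE addrAC subrr add0r expr0 divr1.
    have := @contr (fun=> x) (fun=> 0) c t i (iX 0%N) _ tt.
    rewrite (_ : itv_int 0 t (fun u => (B u *m 0) i 0) = 0); last first.
      case/andP: tt => t0 _.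
      rewrite (@eq_itv_int _ _ _ _ (cst 0)) ?itv_int_cst ?mul0r// => u _.
      by rewrite mulmx0 mxE.
    rewrite subr0 => h; apply: le_trans (h _ _) _; last by lra.
      move=> j; apply: eq_itv_integrable (itv_integrable_cst 0 tau 0) => u _.
      by rewrite mulmx0 mxE.
    by move=> u j _; rewrite mxE subr0; exact: le_l1norm.
  rewrite exprSr invfM mulrA.
  have := @contr (X k.+1) (X k) _ t i (iX k.+1) (iX k) tt ih.
  rewrite [X k.+2]/= [in X k.+1 t i 0]/X /= !mxE.
  by rewrite opprD addrACA subrr add0r.
have [xi xiX] : exists xi : R -> 'cV[R]_n, forall t i k, 0 <= t <= tau ->
    `|xi t i 0 - X k t i 0| <= 2 * c / 2 ^+ k.
  have : forall p : R * 'I_n, exists l : R, 0 <= p.1 <= tau ->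
      forall k, `|l - X k p.1 p.2 0| <= 2 * c / 2 ^+ k.
    (* Outside [[0, tau]] the limit is given the default value 0. *)
    move=> [t i] /=; have [tt|tt] := boolP (0 <= t <= tau); last by exists 0.
    have [l hl] := @dyadic_cauchy (fun k => X k t i 0) c c0 (fun k => Xd k t i tt).
    by exists l.
  move=> /choice[f fP]; exists (fun t => \col_i f (t, i)) => t i k tt.
  by rewrite mxE; exact: (fP (t, i)).
have c20 : 0 <= 2 * c by rewrite mulr_ge0.
have mxi i : itv_measurable 0 tau (fun t => xi t i 0).
  apply: (@measurable_fun_cvg _ _ _ _ (fun k t => X k t i 0)).
    by move=> k; have [+ _] := Xinv k; exact.
  move=> t /=; rewrite in_itv/= => tt; apply/cvgrPdist_le => /= e e0.
  have [k0 hk0] := dyadic_small c20 e0; exists k0 => // k /= kk0.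
  by rewrite (le_trans (xiX t i k tt))// (le_trans (dyadic_antimono c20 kk0)).
(* The 3 is 2 for the distance to the constant iterate [X 0] plus 1 for that iterate itself. *)
have xib t i : 0 <= t <= tau -> `|xi t i 0| <= 3 * c.
  move=> tt; have := xiX t i 0%N tt; rewrite expr0 divr1.
  have := ler_normD (xi t i 0 - X 0%N t i 0) (X 0%N t i 0); rewrite subrK.
  have : `|X 0%N t i 0| <= c by exact: le_l1norm.
  lra.
have ixi := iBY _ _ mxi xib.
exists xi; split=> //.
  move=> t tt; rewrite -[leLHS]ger0_norm ?l1norm_ge0//.
  by apply: normr_sum_ord_le => i; rewrite normr_id; exact: xib.
move=> t i tt.
(* The limit is a fixed point: [X k.+1] is the Picard image of [X k], and it lies dyadically close
   both to [xi] and to the Picard image of [xi]. *)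
apply/eqP; rewrite -subr_eq0 -normr_le0; apply: (@le0_dyadic _ (2 * (2 * c))).
  by rewrite mulr_ge0.
move=> k; have h1 := xiX t i k.+1 tt.
have h2 := @contr xi (X k) _ t i ixi (iX k) tt (fun u j uu => xiX u j k uu).
have h3 : 2 * c / 2 ^+ k.+1 <= 2 * c / 2 ^+ k by exact: dyadic_antimono.
move: h1; rewrite [X k.+1]/= mxE => h1.
set I1 := itv_int 0 t _ in h2 *; set I2 := itv_int 0 t _ in h1 h2.
have := ler_normD (xi t i 0 - (x i 0 + I2)) (I2 - I1).
have -> : xi t i 0 - (x i 0 + I2) + (I2 - I1) = xi t i 0 - (x i 0 + I1) by ring.
rewrite distrC in h2; set z := 2 * c / 2 ^+ k in h2 h3.
have -> : 2 * (2 * c) / 2 ^+ k = 2 * z by rewrite /z; ring.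
have : 0 <= z by rewrite /z divr_ge0// exprn_ge0.
lra.
Qed.

End LinearODE.

(** * The semigroup of a single mode *)

(* Dyadic subdivision: [F 0 tau] is a sum of [2 ^ k] terms of size [4 ^ - k]. *)
Lemma additive_le0 (R : realType) (F : R -> R -> R) (tau C h0 : R) :
  0 <= tau -> 0 <= C -> 0 < h0 ->
  (forall a b c, 0 <= a -> a <= b -> b <= c -> c <= tau ->
    F a c = F a b + F b c) ->
  (forall a b, 0 <= a -> a <= b -> b <= tau -> b - a <= h0 ->
    F a b <= C * (b - a) ^+ 2) ->
  F 0 tau <= 0.
Proof.
move=> tau0 C0 h00 Fadd Fsmall.
have dyadic k : forall a b, 0 <= a -> a <= b -> b <= tau ->
    (b - a) / 2 ^+ k <= h0 -> F a b <= C * (b - a) ^+ 2 / 2 ^+ k.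
  elim: k => [|k ih] a b a0 ab bt.
    by rewrite expr0 !divr1; exact: Fsmall.
  rewrite exprS invfM mulrA => small.
  pose c := (a + b) / 2; have ac : a <= c by rewrite /c; lra.
  have cb : c <= b by rewrite /c; lra.
  have ca : c - a = (b - a) / 2 by rewrite /c; field.
  have bc : b - c = (b - a) / 2 by rewrite /c; field.
  have h1 := ih a c a0 ac (le_trans cb bt); rewrite ca in h1.
  have h2 := ih c b (le_trans a0 ac) cb bt; rewrite bc in h2.
  rewrite (Fadd a c b)// (le_trans (lerD (h1 small) (h2 small)))//.
  rewrite -mulrDl [leRHS]mulrA ler_wpM2r ?invr_ge0 ?exprn_ge0//.
  by rewrite le_eqVlt; apply/orP; left; apply/eqP; field.
have [k0 hk0] := dyadic_small tau0 h00.
apply: (@le0_dyadic _ _ (C * tau ^+ 2)); first by rewrite mulr_ge0 ?sqr_ge0.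
move=> k; apply: (@le_trans _ _ (C * tau ^+ 2 / 2 ^+ (k + k0))).
  have := dyadic (k + k0)%N 0 tau (lexx 0) tau0 (lexx tau); rewrite subr0; apply.
  apply: le_trans hk0; apply: dyadic_antimono => //; exact: leq_addl.
by apply: dyadic_antimono; rewrite ?leq_addr// mulr_ge0 ?sqr_ge0.
Qed.

Section ModeSemigroup.
Context {R : realType} {M n k : nat}.
Variable d : switched_data R M n k.
Local Notation state := 'cV[R]_n.
Hypothesis gam_gt0 : 0 < gam d.
Hypothesis Dmx_sym : forall m, symmetric_mx (Dmx d m).

Lemma trajectory_on_bounded tau w s (xi : R -> state) :
  trajectory_on d 0 tau w s xi ->
  exists2 Y : R, 0 <= Y & forall t, 0 <= t <= tau -> l1norm (xi t) <= Y.
Proof.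
move=> tr; set Z := itv_int 0 tau (fun t => l1norm (velocity d w s xi t)).
exists (l1norm (xi 0) + Z).
  rewrite addr_ge0 ?l1norm_ge0//; apply: itv_int_ge0 => t _; exact: l1norm_ge0.
move=> t tab; have := trajectory_on_displacement tr tab; rewrite -/Z.
have := l1normD (xi 0) (xi t - xi 0); rewrite addrC subrK; lra.
Qed.

(** The gain over [[a, b]] of accumulated cost plus candidate value. At time [t] the remaining time
    is [tau - t], hence the reversed argument of [P]. *)
Definition mode_defect m (tau : R) (P : R -> 'M[R]_n) w (xi : R -> state) a b : R :=
  itv_int a b (running_cost d w (cst m) xi)
  + 2^-1 * qform (P (tau - b)) (xi b) - 2^-1 * qform (P (tau - a)) (xi a).

(** The one-step estimate is used with the matrix [P (tau - b)] of the end of the step; the Taylor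
    expansion from [tau - b] to [tau - a] cancels its first-order term. *)
Lemma mode_defect_estimate (pb : R) : 0 <= pb ->
  exists t0 h0 C : R, [/\ 0 < t0, 0 < h0, 0 <= C &
    forall m P0 T P tau w xi Y a b, riccati_solution d m P0 T P ->
      mxbounded P0 pb -> 0 <= tau <= t0 -> (tau%:E < T)%E ->
      trajectory_on d 0 tau w (cst m) xi ->
      (forall t, 0 <= t <= tau -> l1norm (xi t) <= Y) ->
      0 <= a -> a <= b -> b <= tau -> b - a <= h0 ->
      `|mode_defect m tau P w xi a b + gam d ^+ 2 / 2 *
          feedback_defect d a b w (cst m) xi (P (tau - b))| <=
        C * ((b - a) ^+ 2 * Y ^+ 2
             + (b - a) * feedback_defect d a b w (cst m) xi (P (tau - b)))].
Proof.
move=> pb0; have pb1 : 0 <= pb + 1 by lra.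
have [C1 [t0 [C10 t00 taylor]]] := riccati_solution_taylor d pb0.
have [C2 [h0 [h00 C20 one]]] := one_step_estimate gam_gt0 Dmx_sym pb1.
exists t0, h0, (C1 + C2); split => //; first exact: addr_ge0.
move=> m P0 T P tau w xi Y a b sol P0b /andP[tau0 taut0] tauT tr xiY a0 ab btau bah.
set E := feedback_defect _ _ _ _ _ _ _.
set Q := P (tau - b); set Q' := P (tau - a).
have trab := trajectory_onS a0 ab btau tr.
have taua : ((tau - a)%:E < T)%E.
  by apply: le_lt_trans tauT; rewrite lee_fin; lra.
have [Qb _ Q'Q] : [/\ mxbounded Q (pb + 1),
    mxbounded (Q' - Q) (C1 * (tau - a - (tau - b))) &
    mxbounded (Q' - Q - (tau - a - (tau - b)) *: riccati_rhs d m Q)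
      (C1 * (tau - a - (tau - b)) ^+ 2)].
  by apply: (taylor _ _ _ _ _ _ sol P0b) => //; lra.
have hE : tau - a - (tau - b) = b - a by ring.
rewrite hE in Q'Q.
have sQ : symmetric_mx Q.
  have [_ sP _ _] := sol; apply: sP; first by lra.
  by apply: le_lt_trans tauT; rewrite lee_fin; lra.
have := one Q a b w (cst m) xi sQ Qb ab bah trab.
rewrite -/E (@itv_int_cst R a b (2^-1 * qform (riccati_rhs d m Q) (xi a)))//.
set y := xi a; have yY : l1norm y <= Y by apply: xiY; lra.
have Y0 : 0 <= Y by apply: le_trans yY; exact: l1norm_ge0.
have y2Y : l1norm y ^+ 2 <= Y ^+ 2 by rewrite lerXn2r ?nnegrE ?l1norm_ge0.
have E0 : 0 <= E by exact: feedback_defect_ge0.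
have h2 : 0 <= (b - a) ^+ 2 by exact: sqr_ge0.
have hE0 : 0 <= (b - a) * E by rewrite mulr_ge0// subr_ge0.
have := bform_bound y y Q'Q; rewrite !bformDm !bformNm bformZm -!qformE.
set r := itv_int _ _ _; set G := gam d ^+ 2 / 2 * E.
set fQ := qform (riccati_rhs d m Q) y => h3 h4.
have -> : mode_defect m tau P w xi a b + G =
  (r + 2^-1 * qform Q (xi b) - 2^-1 * qform Q y - 2^-1 * fQ * (b - a) + G)
  - 2^-1 * (qform Q' y - qform Q y - (b - a) * fQ).
  by rewrite /mode_defect -/r -/Q -/Q' -/y; field.
rewrite (le_trans (ler_normB _ _))// normrM [`|2^-1|]ger0_norm//.
have k1 : C1 * ((b - a) ^+ 2 * l1norm y ^+ 2) <= C1 * ((b - a) ^+ 2 * Y ^+ 2).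
  by rewrite !ler_wpM2l.
have k2 : C2 * ((b - a) ^+ 2 * l1norm y ^+ 2) <= C2 * ((b - a) ^+ 2 * Y ^+ 2).
  by rewrite !ler_wpM2l.
have k3 : C1 * (b - a) ^+ 2 * l1norm y * l1norm y = C1 * ((b - a) ^+ 2 * l1norm y ^+ 2).
  by ring.
have k4 : 0 <= C1 * ((b - a) * E) by rewrite mulr_ge0.
have k5 := normr_ge0 (qform Q' y - qform Q y - (b - a) * fQ).
rewrite k3 in h3; lra.
Qed.

Lemma mode_defect_additive m tau P w xi a b c :
  a <= b -> b <= c -> itv_integrable a c (running_cost d w (cst m) xi) ->
  mode_defect m tau P w xi a c =
  mode_defect m tau P w xi a b + mode_defect m tau P w xi b c.
Proof.
move=> ab bc ri; rewrite /mode_defect (@itv_int_split R a b c) ?ab//; ring.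
Qed.

(** On short steps the defect term is absorbed, so each gain is at most a multiple of [(b - a)^2]
    and [additive_le0] sums them to a nonpositive total. The multiple may depend on the trajectory
    through [Y], since it vanishes in the refinement. *)
Lemma mode_cost_le (pb : R) : 0 <= pb ->
  exists2 t0 : R, 0 < t0 & forall m P0 T P tau w xi,
    riccati_solution d m P0 T P -> mxbounded P0 pb -> 0 <= tau <= t0 ->
    (tau%:E < T)%E -> trajectory_on d 0 tau w (cst m) xi ->
    itv_int 0 tau (running_cost d w (cst m) xi) + 2^-1 * qform P0 (xi tau)
      <= 2^-1 * qform (P tau) (xi 0).
Proof.
move=> pb0; have [t0 [h0 [C [t00 h00 C0 est]]]] := mode_defect_estimate pb0.
exists t0 => // m P0 T P tau w xi sol P0b /andP[tau0 taut0] tauT tr.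
have [Y Y0 xiY] := trajectory_on_bounded tr.
have [ri _ _] := trajectory_on_integrable pb0 P0b tau0 tr.
have g2 : 0 < gam d ^+ 2 / 2 by rewrite divr_gt0// exprn_gt0.
pose h1 := Num.min h0 (gam d ^+ 2 / 2 / (C + 1)).
have : mode_defect m tau P w xi 0 tau <= 0.
  apply: (@additive_le0 _ _ tau (C * Y ^+ 2) h1) => //.
  - by rewrite mulr_ge0 ?sqr_ge0.
  - by rewrite lt_min h00 divr_gt0//; lra.
  - move=> a b c a0 ab bc ct; apply: mode_defect_additive => //.
    exact: itv_integrableS ri.
  - move=> a b a0 ab bt; rewrite le_min => /andP[bh0].
    rewrite ler_pdivlMr; last by lra.
    move=> bh1; have tt : 0 <= tau <= t0 by rewrite tau0.
    have := est m P0 T P tau w xi Y a b sol P0b tt tauT tr xiY a0 ab bt bh0.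
    set E := feedback_defect _ _ _ _ _ _ _.
    have E0 : 0 <= E by exact: feedback_defect_ge0.
    rewrite ler_norml => /andP[_ h2].
    have := ler_wpM2r E0 bh1; have : 0 <= (b - a) * E by rewrite mulr_ge0// subr_ge0.
    lra.
have P0E : P 0 = P0 by case: sol.
rewrite /mode_defect subrr subr0 P0E; lra.
Qed.

End ModeSemigroup.

(** * Existence of the optimal feedback trajectory *)

Section ModeSemigroupValue.
Context {R : realType} {M n k : nat}.
Variable d : switched_data R M n k.
Local Notation state := 'cV[R]_n.
Local Notation mu := (@lebesgue_measure R).

Lemma riccati_solution_measurable m (P0 : 'M[R]_n) T P tau i j :
  riccati_solution d m P0 T P -> 0 <= tau -> (tau%:E < T)%E ->
  itv_measurable 0 tau (fun t => P (tau - t) i j).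
Proof.
move=> sol tau0 tauT; have [Pd Pc] := riccati_solution_entry i j sol tauT.
have cP := within_continuous_right tau0 Pd Pc.
have mP : itv_measurable 0 tau (fun t => P t i j).
  by apply: subspace_continuous_measurable_fun.
apply: (@measurable_comp _ _ _ R R R `[0, tau]%classic (fun t => P t i j)
  `[0, tau]%classic (fun t => tau - t)) => //.
- by move=> _ [t /= + <-]; rewrite !in_itv/=; lra.
- by apply: measurable_funB => //; exact: measurable_cst.
Qed.

Lemma feedback_trajectory_exists (pb : R) : 0 <= pb ->
  exists2 t0 : R, 0 < t0 & forall m P0 T P tau (x : state),
    riccati_solution d m P0 T P -> mxbounded P0 pb -> 0 <= tau <= t0 ->
    (tau%:E < T)%E ->
    exists w xi, [/\ disturbance w, trajectory d x tau w (cst m) xi &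
      forall t, 0 <= t <= tau -> w t = feedback d m (P (tau - t)) (xi t)].
Proof.
move=> pb0; have pb1 : 0 <= pb + 1 by lra.
have [t0 t00 Pbd] := riccati_solution_bound d pb0.
have [cA cA0 Ab] := mxbounded_ex (Amx d).
have [cS cS0 Sb] := mxbounded_ex (Sigma_mx d).
pose beta := cA + n%:R * (cS * (pb + 1)).
have beta0 : 0 <= beta by rewrite addr_ge0// !mulr_ge0.
have nb : 0 <= n%:R * beta by rewrite mulr_ge0.
exists (Num.min t0 (2 * (n%:R * beta) + 1)^-1).
  by rewrite lt_min t00 invr_gt0; lra.
move=> m P0 T P tau x sol P0b /andP[tau0]; rewrite le_min => /andP[taut0 taub] tauT.
have Pb t : 0 <= t <= tau -> mxbounded (P (tau - t)) (pb + 1).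
  move=> tt; apply: Pbd sol P0b _ _; first by lra.
  by apply: le_lt_trans tauT; rewrite lee_fin; lra.
have mP i j := riccati_solution_measurable i j sol tau0 tauT.
(* The closed-loop matrix: inserting the feedback turns [sig w] into [Sigma_mx d m] times
   [P (tau - t)] times the state. *)
pose B t := Amx d m + Sigma_mx d m *m P (tau - t).
have [|||xi [mxi xib iBxi xiE]] := @linear_ode R n B x tau beta tau0 beta0.
- move=> i j; rewrite /B; under eq_fun do rewrite !mxE.
  apply: itv_measurableD; first exact: itv_measurable_cst.
  apply: itv_measurable_sum => l.
  by apply: itv_measurableM; [exact: itv_measurable_cst|exact: mP].
- by move=> t tt; exact: mxboundedD (Ab m) (mxboundedM (Sb m) (Pb t tt)).
- apply: (@le_trans _ _ (n%:R * beta * (2 * (n%:R * beta) + 1)^-1)).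
    by rewrite ler_wpM2l.
  by rewrite ler_pdivrMr; lra.
(* A disturbance must be locally square integrable on the whole half-line; cutting off by 0 after
   [tau] makes [w] bounded and measurable everywhere. *)
pose w := (fun t => feedback d m (P (tau - t)) (xi t)) \_ `[0, tau].
have wE t : 0 <= t <= tau -> w t = feedback d m (P (tau - t)) (xi t).
  by move=> tt; rewrite /w patchE mem_set//= in_itv.
have vE t i : 0 <= t <= tau ->
    (B t *m xi t) i 0 = (Amx d m *m xi t + sig d m *m w t) i 0.
  move=> tt; congr (fun_of_matrix _ i 0); rewrite wE// /feedback /B /Sigma_mx.
  by rewrite mulmxDl -scalemxAr -!scalemxAl !mulmxA.
have mw i : measurable_fun setT (fun t => w t i 0).
  have mf : itv_measurable 0 tau (fun t => feedback d m (P (tau - t)) (xi t) i 0).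
    under eq_fun do rewrite mxE.
    apply: itv_measurableM; first exact: itv_measurable_cst.
    apply: itv_measurable_mulmx => j; under eq_fun do rewrite mxE.
    apply: itv_measurable_sum => l; apply: itv_measurableM; [exact: mP|exact: mxi].
  rewrite (_ : (fun t => w t i 0) =
      (fun t => feedback d m (P (tau - t)) (xi t) i 0) \_ `[0, tau]).
    by apply/(measurable_restrictT _ _).1 => //.
  by apply/funext => t; rewrite /w !patchE; case: ifP => // _; rewrite mxE.
have tr : trajectory d x tau w (cst m) xi.
  move=> i; split.
    by apply: eq_itv_integrable (iBxi i) => t tt; exact: vE.
  move=> t /andP[t0' tt]; rewrite xiE ?t0'//; congr (_ + _).
  apply: eq_itv_int => u /andP[u0 ut]; apply: vE.
  by rewrite u0 (le_trans ut).
exists w, xi; split => //; split.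
  by move=> i; apply: measurable_funTS.
have [cf cf0 fb] := l1norm_feedback_bound d pb1.
set Y := n%:R * (3 * l1norm x) in xib.
have w2 t : enorm (w t) ^+ 2 <= (cf * Y) ^+ 2.
  have [tt|tt] := boolP (0 <= t <= tau); last first.
    rewrite /w patchE memNset ?in_itv//=; last by rewrite in_itv/=; exact/negP.
    by rewrite enorm_sqr_sum big1 ?sqr_ge0// => i _; rewrite mxE expr0n.
  have h : l1norm (w t) <= cf * Y.
    by rewrite wE// (le_trans (fb _ _ _ (Pb t tt)))// ler_wpM2l// xib.
  rewrite (le_trans (enorm_le_l1norm _))// lerXn2r ?nnegrE ?l1norm_ge0//.
  by apply: le_trans h; exact: l1norm_ge0.
move=> S.
have : itv_integrable 0 S (fun t => enorm (w t) ^+ 2).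
  apply: (@itv_integrable_bounded _ _ _ _ ((cf * Y) ^+ 2)).
    apply: itv_measurable_enorm_sqr => i; exact: measurable_funTS.
  by move=> t _; rewrite ger0_norm ?sqr_ge0.
move=> /integrableP[_]; apply: le_lt_trans.
by under [leRHS]eq_integral do rewrite /= ger0_norm ?sqr_ge0//.
Qed.

End ModeSemigroupValue.

(** * Optimality of the feedback and the value of a single mode *)

Section ModeSemigroupFlow.
Context {R : realType} {M n k : nat}.
Variable d : switched_data R M n k.
Local Notation state := 'cV[R]_n.
Hypothesis gam_gt0 : 0 < gam d.
Hypothesis Dmx_sym : forall m, symmetric_mx (Dmx d m).

Lemma feedbackB m (P Q : 'M[R]_n) (y z : state) :
  feedback d m P y - feedback d m Q z =
  feedback d m (P - Q) y + feedback d m Q (y - z).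
Proof.
rewrite /feedback -scalerBr -scalerDr -mulmxBr -mulmxDr; congr (_ *: (_ *m _)).
by rewrite mulmxBl mulmxBr addrA subrK.
Qed.

(** Along the exact feedback, [w] differs from the law frozen at the start of a step by a Lipschitz
    error in time, so the defect of a step is of order [(b - a)^3]. The loss per step is then at
    most quadratic and refinement removes it. *)
Lemma mode_cost_ge (pb : R) : 0 <= pb ->
  exists2 t0 : R, 0 < t0 & forall m P0 T P tau w xi,
    riccati_solution d m P0 T P -> mxbounded P0 pb -> 0 <= tau <= t0 ->
    (tau%:E < T)%E -> trajectory_on d 0 tau w (cst m) xi ->
    (forall t, 0 <= t <= tau -> w t = feedback d m (P (tau - t)) (xi t)) ->
    2^-1 * qform (P tau) (xi 0) <=
      itv_int 0 tau (running_cost d w (cst m) xi) + 2^-1 * qform P0 (xi tau).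
Proof.
move=> pb0; have pb1 : 0 <= pb + 1 by lra.
have [t1 [h0 [C [t10 h00 C0 est]]]] := mode_defect_estimate gam_gt0 Dmx_sym pb0.
have [C1 [t2 [C10 t20 taylor]]] := riccati_solution_taylor d pb0.
have [cf cf0 fb] := l1norm_feedback_le d.
have [cA cA0 Ab] := mxbounded_ex (Amx d).
have [cS cS0 Sb] := mxbounded_ex (sig d).
exists (Num.min t1 t2); first by rewrite lt_min t10.
move=> m P0 T P tau w xi sol P0b /andP[tau0]; rewrite le_min => /andP[tt1 tt2].
move=> tauT tr wE.
have [Y Y0 xiY] := trajectory_on_bounded tr.
have [ri _ _] := trajectory_on_integrable pb0 P0b tau0 tr.
have Ptay a t : 0 <= a -> a <= t -> t <= tau ->
    mxbounded (P (tau - t)) (pb + 1) /\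
    mxbounded (P (tau - a) - P (tau - t)) (C1 * (t - a)).
  move=> a0 at_ ttau.
  have [|||h1 h2 _] := taylor m P0 T P (tau - t) (tau - a) sol P0b.
  - by lra.
  - by lra.
  - by apply: le_lt_trans tauT; rewrite lee_fin; lra.
  by split=> //; rewrite (_ : t - a = tau - a - (tau - t))//; ring.
pose V := n%:R * cA * Y + n%:R * cS * (cf * (pb + 1) * Y).
have wY t : 0 <= t <= tau -> l1norm (w t) <= cf * (pb + 1) * Y.
  move=> tt; rewrite wE//; have /andP[tge0 ttau] := tt.
  have [Pb _] := Ptay 0 t (lexx 0) tge0 ttau.
  by rewrite (le_trans (fb _ _ _ _ Pb))// ler_wpM2l ?mulr_ge0// xiY.
have velV t : 0 <= t <= tau -> `|l1norm (velocity d w (cst m) xi t)| <= V.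
  move=> tt; rewrite ger0_norm ?l1norm_ge0// (le_trans (l1normD _ _))// lerD//.
    by rewrite (le_trans (l1norm_mulmx _ (Ab m)))// ler_wpM2l ?mulr_ge0// xiY.
  by rewrite (le_trans (l1norm_mulmx _ (Sb m)))// ler_wpM2l ?mulr_ge0// wY.
have V0 : 0 <= V by rewrite addr_ge0// !mulr_ge0.
(* Lipschitz constant of the feedback in time: the first term comes from the variation of [P], the
   second from that of [xi], whose velocity is at most [V]. *)
pose K := cf * C1 * Y + cf * (pb + 1) * V.
have K0 : 0 <= K by rewrite addr_ge0// !mulr_ge0.
have g2 : 0 < gam d ^+ 2 / 2 by rewrite divr_gt0// exprn_gt0.
have : - mode_defect d m tau P w xi 0 tau <= 0.
  apply: (@additive_le0 _ (fun a b => - mode_defect d m tau P w xi a b) tau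
    (C * Y ^+ 2 + (gam d ^+ 2 / 2 + C) * K ^+ 2) (Num.min h0 1)) => //.
  - by rewrite addr_ge0// mulr_ge0 ?sqr_ge0// addr_ge0// ltW.
  - by rewrite lt_min h00 ltr01.
  - move=> a b c a0 ab bc ct; rewrite -opprD; congr (- _).
    apply: mode_defect_additive => //.
    exact: itv_integrableS ri.
  - move=> a b a0 ab bt; rewrite le_min => /andP[bh0 bh1].
    have tt : 0 <= tau <= t1 by rewrite tau0.
    have := est m P0 T P tau w xi Y a b sol P0b tt tauT tr xiY a0 ab bt bh0.
    have trab := trajectory_onS a0 ab bt tr.
    have [Qb _] := Ptay a b a0 ab bt.
    have [_ _ ei] := trajectory_on_integrable pb1 Qb ab trab.
    set E := feedback_defect _ _ _ _ _ _ _.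
    have E0 : 0 <= E by exact: feedback_defect_ge0.
    have EK : E <= (K * (b - a)) ^+ 2.
      have : E <= (K * (b - a)) ^+ 2 * (b - a).
        rewrite -itv_int_cst//; apply: le_itv_int => //.
          exact: itv_integrable_cst.
        move=> t /andP[at_ tb] /=.
        have ttau : 0 <= t <= tau by rewrite (le_trans a0 at_) (le_trans tb bt).
        rewrite (le_trans (enorm_le_l1norm _))//.
        rewrite lerXn2r ?nnegrE ?l1norm_ge0 ?mulr_ge0 ?subr_ge0//.
        rewrite wE// feedbackB (le_trans (l1normD _ _))//.
        have [_ PQ] := Ptay t b (le_trans a0 at_) tb bt.
        have btba : C1 * (b - t) <= C1 * (b - a) by rewrite ler_wpM2l// lerD2l lerN2.
        have h1 := fb m _ (xi t) _ (mxbounded_le PQ btba).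
        have h2 := fb m _ (xi t - xi a) _ Qb.
        have h3 : l1norm (xi t - xi a) <= V * (b - a).
          have := @trajectory_on_displacement _ _ _ _ d a b w (cst m) xi t trab _.
          rewrite at_ tb => /(_ isT) h; apply: le_trans h _.
          apply: le_trans (ler_norm _) _; apply: itv_int_norm_bound => //.
            exact: l1norm_velocity_integrable trab.
          move=> u /andP[au ub]; apply: velV.
          by rewrite (le_trans a0 au) (le_trans ub bt).
        have h4 := xiY t ttau.
        have cC : 0 <= cf * (C1 * (b - a)) by rewrite !mulr_ge0// subr_ge0.
        have cp : 0 <= cf * (pb + 1) by rewrite mulr_ge0.
        have := ler_wpM2l cC h4; have := ler_wpM2l cp h3.
        rewrite /K; lra.
      by move=> /le_trans; apply; rewrite ler_piMr ?sqr_ge0.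
    have bE : (b - a) * E <= E by rewrite ler_piMl.
    rewrite exprMn in EK.
    rewrite ler_norml => /andP[h1 _].
    have e1 := ler_wpM2l C0 (le_trans bE EK).
    have e2 := ler_wpM2l (ltW g2) EK.
    lra.
have P0E : P 0 = P0 by case: sol.
rewrite /mode_defect subrr subr0 P0E; lra.
Qed.

Lemma semigroup_mode_quadratic (pb : R) : 0 <= pb ->
  exists2 t0 : R, 0 < t0 & forall m P0 T P tau,
    riccati_solution d m P0 T P -> mxbounded P0 pb -> 0 <= tau <= t0 ->
    (tau%:E < T)%E ->
    semigroup_mode d m tau (quadratic P0) = quadratic (P tau).
Proof.
move=> pb0.
have [t1 t10 le1] := mode_cost_le gam_gt0 Dmx_sym pb0.
have [t2 t20 ge2] := mode_cost_ge pb0.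
have [t3 t30 ex3] := feedback_trajectory_exists d pb0.
exists (Num.min t1 (Num.min t2 t3)); first by rewrite !lt_min t10 t20.
move=> m P0 T P tau sol P0b /andP[tau0]; rewrite !le_min => /and3P[tt1 tt2 tt3] tauT.
have tron x w xi : disturbance w -> trajectory d x tau w (cst m) xi ->
    trajectory_on d 0 tau w (cst m) xi /\ xi 0 = x.
  move=> dw tr; apply: (trajectory_on_of tau0 dw _ tr) => m'.
  have [<-|mm'] := eqVneq m m'.
    rewrite (_ : _ @^-1` _ = setT) ?setIT//.
    by apply/seteqP; split.
  rewrite (_ : _ @^-1` _ = set0) ?setI0//.
  by apply/seteqP; split=> //= t; exact/eqP.
apply/funext => x; apply/eqP; rewrite eq_le; apply/andP; split.
  apply: ge_ereal_sup => _ [w [xi [dw tr ->]]].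
  have [tr' x0] := tron x w xi dw tr.
  rewrite /payoff /quadratic -EFinD lee_fin -x0.
  by apply: le1 sol P0b _ tauT tr'; rewrite tau0.
have [w [xi [dw tr wE]]] :=
  ex3 m P0 T P tau x sol P0b (introT andP (conj tau0 tt3)) tauT.
have [tr' x0] := tron x w xi dw tr.
apply: (@le_trans _ _ (payoff d tau (quadratic P0) w (cst m) xi)).
  rewrite /payoff /quadratic -EFinD lee_fin -x0.
  by apply: ge2 sol P0b _ tauT tr' wE; rewrite tau0.
by apply: ereal_sup_ubound; exists w, xi.
Qed.

End ModeSemigroupFlow.

(** * Loewner intervals *)

Section LoewnerBounds.
Context {R : realType}.

Lemma qform_scalar n (c : R) (x : 'cV[R]_n) : qform c%:M x = c * enorm x ^+ 2.
Proof. by rewrite qformE -scalemx1 bformZm enorm_sqr. Qed.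

Lemma loewner_itv_bounds n (eps lam : R) (P : 'M[R]_n) : 0 <= eps ->
  loewner_itv eps%:M lam%:M P ->
  [/\ symmetric_mx P, forall x, 0 <= qform P x &
      forall x, qform P x <= lam * enorm x ^+ 2].
Proof.
move=> eps0 [sP eP Pl]; split=> // x; last by rewrite -qform_scalar.
by apply: le_trans (eP x); rewrite qform_scalar mulr_ge0// sqr_ge0.
Qed.

(* Positivity of [P] at [lam x - P x]. *)
Lemma enorm_mulmx_le n (lam : R) (P : 'M[R]_n) (x : 'cV[R]_n) : 0 < lam ->
  symmetric_mx P -> (forall x, 0 <= qform P x) ->
  (forall x, qform P x <= lam * enorm x ^+ 2) ->
  enorm (P *m x) ^+ 2 <= lam ^+ 2 * enorm x ^+ 2.
Proof.
move=> lam0 sP P0 Pl; set z := P *m x.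
have xz : bform x P z = enorm z ^+ 2.
  by rewrite enorm_sqr /z bform_mull sP mulmx1 bform_mulr.
have := P0 (lam *: x - z); have := Pl z; have := Pl x; rewrite !qformE.
rewrite -scaleN1r !bformDl !bformDr !bformZl !bformZr (bformC z P x) sP xz.
set a := bform x P x; set b := bform z P z; set c := enorm z ^+ 2 => h1 h2 h3.
have h4 : lam * c <= lam * (lam * a) by lra.
rewrite ler_pM2l// in h4; apply: (le_trans h4).
by rewrite expr2 -mulrA ler_pM2l.
Qed.

(** Columns of [P] are images of basis vectors, so their length is at most [lam]. All constants
    thereby become uniform over the Loewner interval. *)
Lemma loewner_itv_mxbounded n (eps lam : R) (P : 'M[R]_n) : 0 <= eps -> 0 < lam ->
  loewner_itv eps%:M lam%:M P -> mxbounded P lam.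
Proof.
move=> eps0 lam0 /(loewner_itv_bounds eps0)[sP P0 Pl] i j.
have e1 : enorm (delta_mx j 0 : 'cV[R]_n) ^+ 2 = 1.
  rewrite enorm_sqr_sum (bigD1 j)//= big1 ?mxE ?eqxx ?expr1n ?addr0// => l lj.
  by rewrite mxE (negPf lj) expr0n.
have := enorm_mulmx_le (delta_mx j 0) lam0 sP P0 Pl.
rewrite e1 mulr1 -colE => h.
have : P i j ^+ 2 <= lam ^+ 2.
  apply: le_trans h; rewrite enorm_sqr_sum (bigD1 i)//= mxE lerDl.
  by rewrite sumr_ge0// => l _; rewrite sqr_ge0.
by rewrite -[P i j ^+ 2]real_normK ?num_real// ler_pXn2r ?nnegrE// ltW.
Qed.

Lemma enorm_sqrZ n (a : R) (x : 'cV[R]_n) : enorm (a *: x) ^+ 2 = a ^+ 2 * enorm x ^+ 2.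
Proof. by rewrite !enorm_sqr bformZl bformZr mulrA expr2. Qed.

Lemma bform0r n m (u : 'cV[R]_n) (A : 'M[R]_(n, m)) : bform u A 0 = 0.
Proof. by rewrite /bform mulmx0 mxE. Qed.

Lemma enorm_eq0 n (x : 'cV[R]_n) : enorm x = 0 -> x = 0.
Proof.
move=> x0; have : enorm x ^+ 2 = 0 by rewrite x0 expr0n.
rewrite enorm_sqr_sum => /eqP; rewrite psumr_eq0 => [/allP h|i _]; last exact: sqr_ge0.
apply/matrixP => i j; rewrite (ord1 j) mxE; apply/eqP.
by have := h i (mem_index_enum _); rewrite sqrf_eq0.
Qed.

Lemma opnorm_le n k (s : 'M[R]_(n, k)) (c : R) (u : 'cV[R]_k) : 0 <= c ->
  opnorm s <= c -> enorm (s *m u) ^+ 2 <= c ^+ 2 * enorm u ^+ 2.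
Proof.
move=> c0 sc; have [u0|u0] := eqVneq (enorm u) 0.
  by rewrite (enorm_eq0 u0) mulmx0 !enorm_sqr !bform0r mulr0.
have ugt0 : 0 < enorm u by rewrite lt_def u0 enorm_ge0.
pose v := (enorm u)^-1 *: u.
have v1 : enorm v <= 1.
  rewrite -(@expr_le1 _ 2) ?enorm_ge0// /v enorm_sqrZ exprVn mulVf//.
  by rewrite sqrf_eq0.
have [cs cs0 sb] := mxbounded_ex (fun _ : unit => s).
(* [sup] dominates the elements of the set only if the set is bounded above, so this must be shown
   before [opnorm] gives any information. *)
have ub : has_ubound [set enorm (s *m v) | v in [set v : 'cV[R]_k | enorm v <= 1]].
  exists (1 + (n%:R * cs) ^+ 2 * k%:R) => _ [z /= z1 <-].
  have h1 : l1norm (s *m z) <= n%:R * cs * l1norm z := l1norm_mulmx z (sb tt).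
  have h2 : l1norm (s *m z) ^+ 2 <= (n%:R * cs * l1norm z) ^+ 2.
    by rewrite lerXn2r ?nnegrE ?mulr_ge0 ?l1norm_ge0.
  have h3 : l1norm z ^+ 2 <= k%:R.
    by rewrite (le_trans (l1norm_sqr z))// ler_piMr// expr_le1 ?enorm_ge0.
  have h4 := ler_wpM2l (sqr_ge0 (n%:R * cs)) h3; rewrite -exprMn in h4.
  have := enorm_le_l1norm (s *m z); have := sqr_ge0 (enorm (s *m z) - 1).
  have := enorm_ge0 (s *m z); lra.
have sv : enorm (s *m v) <= c.
  by apply: le_trans sc; apply: ub_le_sup => //; exists v.
have uE : u = enorm u *: v by rewrite scalerA mulfV// scale1r.
rewrite [in leLHS]uE -scalemxAr enorm_sqrZ mulrC ler_wpM2r ?sqr_ge0//.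
by rewrite lerXn2r ?nnegrE ?enorm_ge0.
Qed.

(* Nonnegativity of [enorm (c ^ 2 y - s s^T y)]. *)
Lemma opnorm_trmx_le n k (s : 'M[R]_(n, k)) (c : R) (y : 'cV[R]_n) : 0 < c ->
  opnorm s <= c -> enorm (s^T *m y) ^+ 2 <= c ^+ 2 * enorm y ^+ 2.
Proof.
move=> c0 sc; set N := enorm (s^T *m y) ^+ 2.
have h1 := opnorm_le (s^T *m y) (ltW c0) sc; rewrite -/N in h1.
have h2 : bform y 1%:M (s *m (s^T *m y)) = N.
  by rewrite /N enorm_sqr bform_mull trmxK mulmx1 !bform_mulr mul1mx.
have := sqr_ge0 (enorm (c ^+ 2 *: y - s *m (s^T *m y))).
rewrite enorm_sqrD enorm_sqrZ enorm_sqrN -scaleN1r bformZl bformZr h2.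
have c2 : 0 < c ^+ 2 by rewrite exprn_gt0.
move=> h3; rewrite -(ler_pM2l c2); lra.
Qed.

End LoewnerBounds.

(** * Switched and pruned steps *)

Section SwitchedStep.
Context {R : realType} {M n k : nat}.
Variable d : switched_data R M n k.
Local Notation state := 'cV[R]_n.
Hypothesis gam_gt0 : 0 < gam d.
Hypothesis Dmx_sym : forall m, symmetric_mx (Dmx d m).

Lemma fin_argmax (I : finType) (disp : Order.disp_t) (T : orderType disp)
    (F : I -> T) (i0 : I)  : exists i, forall j, (F j <= F i)%O.
Proof.
case: (@Order.TotalTheory.arg_maxP _ _ _ i0 predT F isT) => i _ h.
by exists i => j; exact: h.
Qed.

Lemma qform_Sigma_le m (P : 'M[R]_n) (csig lam : R) (y : state) : 0 < csig ->
  0 < lam -> opnorm (sig d m) <= csig -> symmetric_mx P ->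
  (forall x, 0 <= qform P x) -> (forall x, qform P x <= lam * enorm x ^+ 2) ->
  qform (P *m Sigma_mx d m *m P) y <=
    csig ^+ 2 / gam d ^+ 2 * lam ^+ 2 * enorm y ^+ 2.
Proof.
move=> c0 lam0 sc sP P0 Pl.
have -> : qform (P *m Sigma_mx d m *m P) y =
    (gam d ^+ 2)^-1 * enorm ((sig d m)^T *m (P *m y)) ^+ 2.
  rewrite /Sigma_mx -scalemxAr -scalemxAl qformE bformZm enorm_sqr.
  by rewrite !bform_mull !bform_mulr trmxK sP mulmx1 !mulmxA.
have h1 := opnorm_trmx_le (P *m y) c0 sc.
have h2 := enorm_mulmx_le y lam0 sP P0 Pl.
have g0 : 0 <= (gam d ^+ 2)^-1 by rewrite invr_ge0 sqr_ge0.
have h3 := ler_wpM2l (sqr_ge0 csig) h2.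
have := ler_wpM2l g0 (le_trans h1 h3); lra.
Qed.

(** The linear part is homogeneous; the quadratic part gains and the constant part loses under
    scaling. The bracket is the source of the contraction. *)
Lemma riccati_rhs_scale m (P : 'M[R]_n) (e : R) y :
  qform (riccati_rhs d m ((1 + e) *: P)) y =
  (1 + e) * qform (riccati_rhs d m P) y
  + e * ((1 + e) * qform (P *m Sigma_mx d m *m P) y - qform (Dmx d m) y).
Proof.
rewrite /riccati_rhs !qformE !bformDm -!scalemxAl -!scalemxAr -!scalemxAl !bformZm.
ring.
Qed.

(** Invariance supplies the flow at time [tau] and keeps it in the interval; for small [tau] it
    agrees with the semigroup, and the last clause is the lower half of the Taylor expansion. *)
Lemma mode_flow_step (eps lam : R) : 0 < eps -> 0 < lam ->
  (forall (m : 'I_M) (t : R) (P0 : 'M[R]_n), 0 <= t ->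
      loewner_itv eps%:M lam%:M P0 ->
      exists Q, riccati_flow d m t P0 Q /\ loewner_itv eps%:M lam%:M Q) ->
  exists t0 C : R, [/\ 0 < t0, 0 <= C & forall m P tau, 0 < tau <= t0 ->
    loewner_itv eps%:M lam%:M P ->
    exists Q, [/\ loewner_itv eps%:M lam%:M Q,
      semigroup_mode d m tau (quadratic P) = quadratic Q &
      forall y, qform P y + tau * qform (riccati_rhs d m P) y <=
        qform Q y + C * tau ^+ 2 * enorm y ^+ 2]].
Proof.
move=> eps0 lam0 hinv.
have [t1 t10 sm] := semigroup_mode_quadratic gam_gt0 Dmx_sym (ltW lam0).
have [C [t2 [C0 t20 taylor]]] := riccati_solution_taylor d (ltW lam0).
exists (Num.min t1 t2), (C * n%:R); split; first by rewrite lt_min t10.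
  by rewrite mulr_ge0.
move=> m P tau /andP[tau0]; rewrite le_min => /andP[tt1 tt2] Pi.
have [Q [[T [P' [[T0 sol _] _ tauT PQ]]] Qi]] := hinv m tau P (ltW tau0) Pi.
have Pb := loewner_itv_mxbounded (ltW eps0) lam0 Pi.
have P0 : P' 0 = P by case: sol.
exists Q; split=> //.
  by rewrite -PQ; apply: sm sol Pb _ tauT; rewrite ltW.
move=> y; have [|//|//|_ _] := taylor m P T P' 0 tau sol Pb; first by rewrite lexx ltW.
rewrite PQ P0 subr0 => /(bform_bound y y).
rewrite !bformDm !bformNm bformZm -!qformE ler_norml => /andP[h _].
have h2 := l1norm_sqr y.
have := ler_wpM2l (mulr_ge0 C0 (sqr_ge0 tau)) h2; lra.
Qed.

Lemma switched_step_le (csig mD eps lam kap : R) : 0 < eps -> 0 < lam ->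
  0 < csig -> (0 < M)%N ->
  (forall m, opnorm (sig d m) <= csig) ->
  (forall m (x : state), mD * enorm x ^+ 2 <= qform (Dmx d m) x) ->
  exists h0 C : R, [/\ 0 < h0, 0 <= C & forall P e a b w s (xi : R -> state),
    loewner_itv eps%:M lam%:M P -> 0 <= e <= 1 ->
    (1 + e) * (csig ^+ 2 / gam d ^+ 2 * lam ^+ 2) <= mD - kap ->
    a <= b -> b - a <= h0 -> trajectory_on d a b w s xi ->
    exists m, itv_int a b (running_cost d w s xi)
        + (1 + e) * (2^-1 * qform P (xi b)) <=
      (1 + e) * (2^-1 * (qform P (xi a) + (b - a) * qform (riccati_rhs d m P) (xi a)))
      - 2^-1 * e * kap * (b - a) * enorm (xi a) ^+ 2
      + C * (b - a) ^+ 2 * enorm (xi a) ^+ 2].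
Proof.
move=> eps0 lam0 c0 M0 sc Dm.
have pb0 : 0 <= 2 * lam by lra.
have [C [h0 [h00 C0 one]]] := one_step_estimate gam_gt0 Dmx_sym pb0.
have g2 : 0 < gam d ^+ 2 / 2 by rewrite divr_gt0// exprn_gt0.
exists (Num.min h0 (gam d ^+ 2 / 2 / (C + 1))), (C * n%:R); split.
- by rewrite lt_min h00 divr_gt0//; lra.
- by rewrite mulr_ge0.
move=> P e a b w s xi Pi /andP[e0 e1] small ab; rewrite le_min => /andP[bh0].
rewrite ler_pdivlMr; last by lra.
move=> bh1 tr; set y := xi a.
have [sP P0 Pl] := loewner_itv_bounds (ltW eps0) Pi.
have Pb := loewner_itv_mxbounded (ltW eps0) lam0 Pi.
pose Q := (1 + e) *: P.
have sQ : symmetric_mx Q by rewrite /symmetric_mx /Q linearZ /= sP.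
have Qb : mxbounded Q (2 * lam).
  apply: mxbounded_le (mxboundedZ (1 + e) Pb) _.
  by rewrite ger0_norm ?addr_ge0// ler_pM2r//; lra.
have [m mmax] := fin_argmax (fun m => qform (riccati_rhs d m Q) y) (Ordinal M0).
exists m.
have ba0 : 0 <= b - a by rewrite subr_ge0.
have := one Q a b w s xi sQ Qb ab bh0 tr; rewrite -/y.
set E := feedback_defect _ _ _ _ _ _ _.
have E0 : 0 <= E by exact: feedback_defect_ge0.
rewrite ler_norml => /andP[_].
have [_ pi _] := trajectory_on_integrable pb0 Qb ab tr.
have : itv_int a b (fun t => 2^-1 * qform (riccati_rhs d (s t) Q) y) <=
    2^-1 * qform (riccati_rhs d m Q) y * (b - a).
  rewrite -itv_int_cst//; apply: le_itv_int => //; first exact: itv_integrable_cst.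
  by move=> t _ /=; rewrite ler_pM2l//; exact: mmax.
set I := itv_int a b (fun t => _) => IQ.
have qQ x : qform Q x = (1 + e) * qform P x by rewrite !qformE /Q bformZm.
rewrite !qQ => h1.
have h2 : qform (riccati_rhs d m Q) y <=
    (1 + e) * qform (riccati_rhs d m P) y - e * kap * enorm y ^+ 2.
  rewrite /Q riccati_rhs_scale lerD2l.
  have h3 := qform_Sigma_le y c0 lam0 (sc m) sP P0 Pl.
  have h4 := Dm m y.
  have e1' : 0 <= 1 + e by lra.
  have h5 := ler_wpM2l e1' h3.
  have h6 := ler_wpM2r (sqr_ge0 (enorm y)) small.
  have : (1 + e) * qform (P *m Sigma_mx d m *m P) y - qform (Dmx d m) y <=
      - (kap * enorm y ^+ 2) by lra.
  move=> /(ler_wpM2l e0); lra.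
have h7 := ler_wpM2r ba0 h2.
have h8 := ler_wpM2r E0 bh1.
have h9 : 0 <= (b - a) * E by rewrite mulr_ge0.
have h10 := ler_wpM2l (mulr_ge0 C0 (sqr_ge0 (b - a))) (l1norm_sqr y).
lra.
Qed.

End SwitchedStep.

(** * Pruned families and comparison of the error rates *)

Section PruningRates.
Context {R : realType}.

Definition itv_family n (eps lam : R) (F : Defs.family R n) : Prop :=
  inhabited (idx F) /\
  forall i, exists Q, loewner_itv eps%:M lam%:M Q /\ F i = quadratic Q.

Lemma itv_family_attained n (eps lam : R) (F : Defs.family R n) x :
  itv_family eps lam F -> exists i, fsup F x = F i x.
Proof.
move=> [[i0] _]; have [i imax] := fin_argmax (fun i => F i x) i0.
exists i; apply/eqP; rewrite eq_le; apply/andP; split.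
  by apply: ge_ereal_sup => _ [j _ <-]; exact: imax.
by apply: ereal_sup_ubound; exists i.
Qed.

Lemma itv_family_fsup n (eps lam : R) (F : Defs.family R n) x : 0 <= eps ->
  itv_family eps lam F ->
  exists i Q, [/\ loewner_itv eps%:M lam%:M Q, F i = quadratic Q,
    fsup F x = (2^-1 * qform Q x)%:E &
    0 <= 2^-1 * qform Q x <= 2^-1 * lam * enorm x ^+ 2].
Proof.
move=> eps0 FF; have [i iE] := itv_family_attained x FF.
have [_ /(_ i)[Q [Qi QE]]] := FF; exists i, Q; split=> //; first by rewrite iE QE.
have [_ Q0 Ql] := loewner_itv_bounds eps0 Qi.
by have := Q0 x; have := Ql x; lra.
Qed.

Lemma itv_family_prune n (eps lam r L : R) (p : R -> pruning R n) tau
    (F : Defs.family R n) :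
  0 <= eps -> itv_family eps lam F ->
  (forall x, (fsup F x <= (1 + L * tau `^ r)%:E * fsup (prune (p tau) F) x)%E) ->
  0 <= L -> itv_family eps lam (prune (p tau) F).
Proof.
move=> eps0 FF le L0; split; last by move=> i; case: FF => _; apply.
(* An empty selection would have supremum [-oo]; at the origin this contradicts the pruning bound,
   since the unpruned value is finite. *)
have [i|p0] := pickP (mem (p tau F)).
  by move=> ip; exact: (inhabits (exist _ i ip)).
have [i [Q [_ _ FE]]] := itv_family_fsup 0 eps0 FF.
have := le 0; rewrite FE.
have -> : fsup (prune (p tau) F) 0 = -oo%E.
  rewrite /fsup; set A := (X in ereal_sup X); suff -> : A = set0 by rewrite ereal_sup0.
  apply/seteqP; split=> // y [[j jp] _ _].
  by have := p0 j; rewrite /= jp.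
by rewrite gt0_muleNy// lte_fin ltr_wpDr// mulr_ge0// powR_ge0.
Qed.

(** For [tau <= 1] a smaller exponent gives a larger power: the exponent is at most 1, which handles
    [tau^2], and at most [r - 1], which handles [tau^r]. The threshold [e^(1 / rho)] makes the rate
    itself at most [e]. *)
Lemma rate_powR (r : R) : 1 < r -> forall e : R, 0 < e ->
  exists2 t0 : R, 0 < t0 <= 1 & forall tau, 0 < tau <= t0 ->
    let q := tau `^ Num.min 1 (r - 1) in
    [/\ 0 < q, q <= e, tau ^+ 2 <= tau * q & tau `^ r <= tau * q].
Proof.
move=> r1 e e0; set rho := Num.min 1 (r - 1).
have rho0 : 0 < rho by rewrite lt_min ltr01 subr_gt0.
have rho1 : rho <= 1 by rewrite ge_min lexx.
have rhor : rho <= r - 1 by rewrite ge_min lexx orbT.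
exists (Num.min 1 (e `^ rho^-1)).
  by rewrite lt_min ltr01 powR_gt0//= ge_min lexx.
move=> tau /andP[tau0]; rewrite le_min => /andP[tau1 taue] /=.
have tau01 : 0 < tau <= 1 by rewrite tau0.
split.
- exact: powR_gt0.
- have := @ge0_ler_powR R rho (ltW rho0) tau (e `^ rho^-1).
  rewrite !nnegrE ltW// powR_ge0 => /(_ isT isT taue).
  by rewrite -powRrM mulVf ?gt_eqF// powRr1// ltW.
- by rewrite expr2 ler_pM2l// ger1_powR.
- rewrite -(mulr_powRB1 (ltW tau0)); last by lra.
  by rewrite ler_pM2l// ger_powR.
Qed.

End PruningRates.

(** * Choice of the constants and backward induction *)

Theorem theorem5p1 (R : realType) (M n k : nat) (d : switched_data R M n k)
    (cA csig cD mD : R) (r lam eps : R) (p : R -> pruning R n)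
    (hM : (0 < M)%N)
    (hgam : 0 < gam d)
    (hD : forall m : 'I_M, symmetric_mx (Dmx d m))
    (hA1 : assumption_A1 d cA csig cD)
    (hA2 : assumption_A2 d cA csig cD mD)
    (hr : 1 < r)
    (hp : pruning_error p r)
    (hlam : lambda1 d cA csig cD <= lam < lambda2 d csig mD)
    (heps : 0 < eps)
    (hinv : forall (m : 'I_M) (t : R) (P0 : 'M[R]_n), 0 <= t ->
      loewner_itv eps%:M lam%:M P0 ->
      exists Q, riccati_flow d m t P0 Q /\ loewner_itv eps%:M lam%:M Q) :
  exists tau0 L : R, [/\ 0 < tau0, 0 < L &
    forall (N : nat) (tau : R) (P0 : 'M[R]_n),
      0 < tau <= tau0 -> loewner_itv eps%:M lam%:M P0 ->
      forall x : 'cV[R]_n,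
        (semigroup d (N%:R * tau) (quadratic P0) x
         - pruned_iteration d p tau N (quadratic P0) x
         <= (L * tau `^ (Num.min 1 (r - 1)) * enorm x ^+ 2)%:E)%E].
Proof.
have [[cA0 csig0 cD0] _ sc _ cAD] := hA1.
have [mD0 Dm _] := hA2.
have /andP[lam1 lam2] := hlam.
have g2 : 0 < gam d ^+ 2 by rewrite exprn_gt0.
have c2 : 0 < csig ^+ 2 by rewrite exprn_gt0.
have lam0 : 0 < lam.
  apply: lt_le_trans lam1; rewrite /lambda1 divr_gt0// mulr_gt0// subr_gt0.
  have del0 : 0 < cD * csig ^+ 2 / gam d ^+ 2 by rewrite divr_gt0// mulr_gt0.
  rewrite -[ltRHS]gtr0_norm// -sqrtr_sqr ltr_sqrt ?exprn_gt0//; lra.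
(* [theta] bounds the form of [P Sigma P] on the Loewner interval; [theta < mD] is the inequality
   [lam < lambda2] squared. *)
set theta := csig ^+ 2 / gam d ^+ 2 * lam ^+ 2.
have theta0 : 0 < theta by rewrite mulr_gt0 ?divr_gt0// exprn_gt0.
have thm : theta < mD.
  have l2 : lam ^+ 2 < mD * gam d ^+ 2 / csig ^+ 2.
    have x0 : 0 <= mD * gam d ^+ 2 / csig ^+ 2 by rewrite ltW// divr_gt0// mulr_gt0.
    rewrite -(sqr_sqrtr x0) ltr_pXn2r ?nnegrE ?sqrtr_ge0//; exact: ltW.
  rewrite (_ : mD = csig ^+ 2 / gam d ^+ 2 * (mD * gam d ^+ 2 / csig ^+ 2)).
    by rewrite ltr_pM2l// divr_gt0.
  by field; rewrite !gt_eqF.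
have [L L0 pe] := hp.
have [t1 [C1 [t10 C10 flow]]] := mode_flow_step hgam hD heps lam0 hinv.
(* Half of the gap is kept as gain; the other half pays for the factor [1 + dl] in front of [theta],
   which is why [dmax] contains [kap / theta]. *)
pose kap := (mD - theta) / 2.
have kap0 : 0 < kap by rewrite divr_gt0// subr_gt0.
have [h0 [C2 [h00 C20 sstep]]] :=
  switched_step_le hgam hD kap heps lam0 csig0 hM sc Dm.
(* [K] is chosen so that the gain [dl * kap * tau / 2] equals the sum of the
   pruning, Riccati and one-step errors, see [k6]. *)
pose K := 2 * (L * lam + C1 + C2) / kap.
have K0 : 0 < K.
  by rewrite divr_gt0// mulr_gt0// -addrA ltr_wpDr ?addr_ge0// mulr_gt0.
pose dmax := Num.min 1 (kap / theta).
have dmax0 : 0 < dmax by rewrite lt_min ltr01 divr_gt0.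
have [t2 /andP[t20 t21] rate] := rate_powR hr (divr_gt0 dmax0 K0).
exists (Num.min (Num.min t1 h0) t2), (2^-1 * K * lam); split.
- by rewrite !lt_min t10 h00.
- by apply: mulr_gt0 lam0; apply: mulr_gt0 K0; rewrite invr_gt0.
move=> N tau P0 /andP[tau0]; rewrite !le_min => /andP[/andP[tt1 th0] tt2] P0i x.
have [q0 qe tq trq] := rate tau (introT andP (conj tau0 tt2)).
set q := tau `^ _ in q0 qe tq trq *.
pose dl := K * q.
have dl0 : 0 <= dl by rewrite mulr_ge0// ltW.
have : dl <= dmax by rewrite /dl mulrC -ler_pdivlMr.
rewrite le_min => /andP[dl1 dlk].
have small : (1 + dl) * theta <= mD - kap.
  have : dl * theta <= kap by rewrite -ler_pdivlMr.
  by rewrite /kap; lra.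
pose Fam j := iter j (fun F => prune (p tau) (semigroup_family d tau F))
    (@Family R n unit (fun _ => quadratic P0)).
have sfam F : itv_family eps lam F -> itv_family eps lam (semigroup_family d tau F).
  move=> [[i0] FQ]; split; first exact: (inhabits (Ordinal hM, i0)).
  move=> [m i]; have [P [Pi FE]] := FQ i.
  have [Q [Qi QE _]] := flow m P tau (introT andP (conj tau0 tt1)) Pi.
  by exists Q; split=> //; rewrite /= FE QE.
have pef F : itv_family eps lam F -> forall x,
    (fsup F x <= (1 + L * tau `^ r)%:E * fsup (prune (p tau) F) x)%E.
  move=> [_ FQ] y; have [] := pe tau F tau0 _ _ y => //.
    by move=> i; have [Q [[sQ _ _] QE]] := FQ i; exists Q.
  move=> i z; have [Q [Qi ->]] := FQ i.
  have [_ Q0 _] := loewner_itv_bounds (ltW heps) Qi.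
  by rewrite /quadratic lee_fin mulr_ge0.
have famI j : itv_family eps lam (Fam j).
  elim: j => [|j ih]; first by split=> [|i]; [exact: (inhabits tt)|by exists P0].
  have sj := sfam _ ih.
  exact: itv_family_prune (ltW heps) sj (pef _ sj) (ltW L0).
have [iN [QN [_ _ fN vN]]] := itv_family_fsup x (ltW heps) (famI N).
(* The pruned value is finite, so it can be moved to the right before the supremum defining the
   semigroup is opened. *)
rewrite /pruned_iteration -/(Fam N) fN leeBlDr// -EFinD.
apply: ge_ereal_sup => _ [w [s [xi [dw ss tr ->]]]].
set T := N%:R * tau in ss tr *.
have T0 : 0 <= T by rewrite mulr_ge0// ltW.
have [trT x0] := trajectory_on_of T0 dw ss tr.
have pb0 := ltW lam0.
have P0b := loewner_itv_mxbounded (ltW heps) lam0 P0i.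
have [ri _ _] := trajectory_on_integrable pb0 P0b T0 trT.
pose J := (1 + dl) * (2^-1 * qform P0 (xi T)).
(* [j] counts the steps still to go: the induction starts at the final time, where [Fam 0] is the
   terminal cost, and moves back by one step. *)
have main j : (j <= N)%N ->
  itv_int ((N - j)%:R * tau) T (running_cost d w s xi) + J <=
  (1 + dl) * fine (fsup (Fam j) (xi ((N - j)%:R * tau))).
  elim: j => [_|j ih jN].
    rewrite subn0 itv_int_point add0r /Fam /=.
    have -> : fsup (@Family R n unit (fun=> quadratic P0)) (xi T) =
        quadratic P0 (xi T).
      rewrite /fsup /=; set A := (X in ereal_sup X).
      suff -> : A = [set quadratic P0 (xi T)] by rewrite ereal_sup1.
      by apply/seteqP; split=> [_ [i _ <-]//|_ ->]; exists tt.
    by rewrite /J.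
  set a := (N - j.+1)%:R * tau; set b := (N - j)%:R * tau in ih.
  have ba : b - a = tau.
    by rewrite /b /a -(subnSK jN) -natr1; ring.
  have a0 : 0 <= a by rewrite mulr_ge0// ltW.
  have bT : b <= T by rewrite ler_pM2r// ler_nat leq_subr.
  have ab : a <= b by lra.
  have trab := trajectory_onS a0 ab bT trT.
  have [i [P [Pi FP fE _]]] := itv_family_fsup (xi b) (ltW heps) (famI j).
  have bah : b - a <= h0 by rewrite ba.
  have [m step] := sstep P dl a b w s xi Pi (introT andP (conj dl0 dl1)) small ab
    bah trab.
  have [Q [Qi QE Qle]] := flow m P tau (introT andP (conj tau0 tt1)) Pi.
  have [i' [Q' [_ _ fE' vE']]] := itv_family_fsup (xi a) (ltW heps) (famI j.+1).
  set y := xi a in step vE' fE' *; set v := 2^-1 * qform Q' y in fE' vE'.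
  (* The pair of the best mode and the maximising index belongs to the family before pruning, so [Q]
     is dominated at the cost of one pruning factor. *)
  have h1 : 2^-1 * qform Q y <= (1 + L * tau `^ r) * v.
    rewrite -lee_fin [leRHS]EFinM -fE'; apply: le_trans (pef _ (sfam _ (famI j)) y).
    apply: ereal_sup_ubound; exists (m, i) => //=.
    by rewrite FP QE.
  have := ih (ltnW jN); rewrite fE fE' /= => h2.
  rewrite (@itv_int_split R a b T) ?ab//; last exact: itv_integrableS ri.
  rewrite ba in step.
  have h3 := Qle y.
  have Y0 : 0 <= enorm y ^+ 2 by exact: sqr_ge0.
  set Y := enorm y ^+ 2 in Y0 h3 step vE'.
  have dlD0 : 0 <= 1 + dl by lra.
  have /andP[v0 vY] := vE'.
  have tq0 : 0 <= tau * q by exact: ltW (mulr_gt0 tau0 q0).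
  have lamY : 0 <= 2^-1 * lam * Y.
    by apply: mulr_ge0 Y0; apply: mulr_ge0 (ltW lam0); rewrite invr_ge0.
  have k1 := ler_wpM2l dlD0 h3; have k2 := ler_wpM2l dlD0 h1.
  have k3 : L * tau `^ r * v <= L * (tau * q) * (2^-1 * lam * Y).
    by apply: ler_pM => //; [exact: mulr_ge0 (ltW L0) (powR_ge0 _ _)|rewrite ler_pM2l].
  have k4 : C1 * tau ^+ 2 * Y <= C1 * (tau * q) * Y by rewrite ler_wpM2r// ler_wpM2l.
  have k5 : C2 * tau ^+ 2 * Y <= C2 * (tau * q) * Y by rewrite ler_wpM2r// ler_wpM2l.
  have k6 : 2^-1 * dl * kap * tau * Y = (L * lam + C1 + C2) * (tau * q * Y).
    by rewrite /dl /K; field; rewrite gt_eqF.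
  have m1 := ler_wpM2l dlD0 k3; have m2 := ler_wpM2l dlD0 k4.
  (* The pruning and Riccati errors carry the factor [1 + dl]; as [dl <= 1] it is at most 2 and
     cancels the halves in front of these errors. *)
  have dlB0 : 0 <= 1 - dl by rewrite subr_ge0.
  have z1 := mulr_ge0 dlB0 (mulr_ge0 (mulr_ge0 (ltW L0) tq0) lamY).
  have z2 := mulr_ge0 dlB0 (mulr_ge0 (mulr_ge0 C10 tq0) Y0).
  rewrite k6 in step.
  lra.
have := main N (leqnn N); rewrite subnn mul0r x0 fN /= => mainN.
rewrite /payoff /quadratic -EFinD lee_fin.
have P0x : 0 <= 2^-1 * qform P0 (xi T).
  by have [_ P00 _] := loewner_itv_bounds (ltW heps) P0i; rewrite mulr_ge0.
have h1 := mulr_ge0 dl0 P0x.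
have /andP[_ vN2] := vN; have h2 := ler_wpM2l dl0 vN2.
rewrite -/(itv_int 0 T (running_cost d w s xi)).
rewrite /J in mainN; rewrite /dl in h1 h2 mainN; lra.
Qed.
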